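(* Let $G$ be a finite cyclic group of order $N$, $\mathbf{k}$ a commutative $\mathbb{Q}$-algebra, and $\iota:G\to\mathbb{C}^\times$ a group embedding. There is a unique topological $\mathbf{k}$-algebra isomorphism $\mathrm{iso}^{\mathcal V,\iota}:\widehat{\mathcal V}^{\mathrm B}_N\to\widehat{\mathcal V}^{\mathrm{DR}}_G$ given by $$X_0\mapsto\exp\Big(\frac1Ne_0\Big)g_\iota,\qquad X_1\mapsto\exp(e_1),$$ where $g_\iota=\iota^{-1}(e^{2\pi i/N})$.
   Context: $\widehat{\mathcal V}^{\mathrm{DR}}_G$ is the complete graded $\mathbf{k}$-algebra generated by $e_0,e_1$ (degree $1$) and the elements of $G$ (degree $0$), with relations: the product of $g,h\in G$ is $gh$, the unit of $G$ is $1$, and $ge_0=e_0g$ for $g\in G$; it is topologized by the degree filtration. $F_2$ is the free group on $X_0,X_1$, $\mu_N\subset\mathbb{C}^\times$ is the group of $N$-th roots of unity, $\mathcal V^{\mathrm B}_N:=\mathbf{k}F_2$ is the group algebra with the filtration $\mathcal F^m\mathcal V^{\mathrm B}_N=\mathcal I^m$ ($m\ge0$, $\mathcal I^0=\mathbf{k}F_2$), where $\mathcal I$ is the kernel of the algebra morphism $\mathbf{k}F_2\to\mathbf{k}\mu_N$ induced by $X_0\mapsto e^{2\pi i/N}$, $X_1\mapsto1$, and $\widehat{\mathcal V}^{\mathrm B}_N:=\varprojlim\mathcal V^{\mathrm B}_N/\mathcal F^m\mathcal V^{\mathrm B}_N$ with the inverse limit filtration topology. *)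

(* Defs.v *)
From HB Require Import structures.
From mathcomp Require Import all_boot all_order all_algebra fingroup cyclic.
From mathcomp Require Import finmap generic_quotient complex.
From mathcomp Require Import boolp classical_sets reals topology trigo.
From mathcomp Require Import monalg.

Set Implicit Arguments.
Unset Strict Implicit.
Unset Printing Implicit Defensive.

Import Order.TTheory GRing.Theory Num.Theory.

Local Open Scope fset_scope.
Local Open Scope classical_set_scope.
Local Open Scope quotient_scope.
Local Open Scope ring_scope.

(* The library's algType requires 1 != 0.  This excludes the quotients A / F^0
   occurring in completions, as well as all algebras over the zero ring.  Hence
   a k-algebra is taken here to be a possibly zero ring A with a ring morphism
   from k to the center of A; the scalar multiple of x by a is alg_map a * x. *)
HB.mixin Record isPzAlgebra (k : comPzRingType) A of GRing.PzRing A := {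
  alg_map : {rmorphism k -> A};
  alg_mapC : forall (a : k) (x : A), alg_map a * x = x * alg_map a
}.

#[short(type="pzAlgType")]
HB.structure Definition PzAlgebra (k : comPzRingType) :=
  {A of GRing.PzRing A & isPzAlgebra k A}.

Record ideal (A : pzRingType) := Ideal {
  ideal_set :> A -> Prop;
  ideal0 : ideal_set 0;
  idealB : forall x y, ideal_set x -> ideal_set y -> ideal_set (x - y);
  idealMl : forall a x, ideal_set x -> ideal_set (a * x);
  idealMr : forall x a, ideal_set x -> ideal_set (x * a)
}.

Section Ideals.
Variable A : pzRingType.
Implicit Types I J : ideal A.

Lemma idealN I x : I x -> I (- x).
Proof. by move=> Ix; rewrite -[- x]add0r; apply: idealB => //; apply: ideal0. Qed.

Lemma idealD I x y : I x -> I y -> I (x + y).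
Proof. by move=> Ix Iy; rewrite -[y]opprK; apply/idealB/idealN. Qed.

Definition full_ideal : ideal A.
Proof. by exists setT. Defined.

Definition gen_set (S : set A) : set A :=
  [set x | forall J : ideal A, (forall y, S y -> J y) -> J x].

Definition ideal_gen (S : set A) : ideal A.
Proof.
exists (gen_set S).
- by move=> J _; apply: ideal0.
- by move=> x y Sx Sy J SJ; apply: idealB; [apply: Sx|apply: Sy].
- by move=> a x Sx J SJ; apply/idealMl/Sx.
- by move=> x a Sx J SJ; apply/idealMr/Sx.
Defined.

Definition mul_set (I J : ideal A) : set A :=
  [set x | exists2 s : seq (A * A), (forall p, p \in s -> I p.1 /\ J p.2)
                                  & x = \sum_(p <- s) p.1 * p.2].

Definition ideal_mul I J : ideal A.
Proof.
exists (mul_set I J).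
- by exists [::] => //; rewrite big_nil.
- move=> _ _ [s sP ->] [t tP ->].
  exists (s ++ [seq (- p.1, p.2) | p <- t]).
    move=> p; rewrite mem_cat => /orP[/sP //|/mapP[q /tP [q1 q2] ->]] /=.
    by split=> //; apply: idealN.
  rewrite big_cat big_map -sumrN; congr (_ + _).
  by apply: eq_bigr => p _ /=; rewrite mulNr.
- move=> a _ [s sP ->]; exists [seq (a * p.1, p.2) | p <- s].
    by move=> p /mapP[q /sP [q1 q2] ->] /=; split=> //; apply: idealMl.
  by rewrite big_map mulr_sumr; apply: eq_bigr => p _ /=; rewrite mulrA.
- move=> _ a [s sP ->]; exists [seq (p.1, p.2 * a) | p <- s].
    by move=> p /mapP[q /sP [q1 q2] ->] /=; split=> //; apply: idealMr.
  by rewrite big_map mulr_suml; apply: eq_bigr => p _ /=; rewrite mulrA.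
Defined.

Fixpoint ideal_pow I m : ideal A :=
  if m is m'.+1 then ideal_mul I (ideal_pow I m') else full_ideal.

Lemma ideal_mul_subr I J x : ideal_mul I J x -> J x.
Proof.
move=> [s sP ->]; rewrite big_seq; elim/big_ind: _; first exact: ideal0.
  by move=> y z; apply: idealD.
by move=> p /sP [_ Jp]; apply: idealMl.
Qed.

End Ideals.

Definition ker_ideal (A B : pzRingType) (f : {rmorphism A -> B}) : ideal A.
Proof.
exists [set x | f x = 0].
- by rewrite /= rmorph0.
- by move=> x y /= fx fy; rewrite rmorphB fx fy subrr.
- by move=> a x /= fx; rewrite rmorphM fx mulr0.
- by move=> x a /= fx; rewrite rmorphM fx mul0r.
Defined.

Section Quotient.
Variables (k : comPzRingType) (A : pzAlgType k) (I : ideal A).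

Definition ideal_equiv (x y : A) : bool := `[< I (x - y) >].

Lemma ideal_equiv_class : equiv_class_of ideal_equiv.
Proof.
split=> [x|x y|y x z].
- by apply/asboolP; rewrite subrr; apply: ideal0.
- by apply/asboolP/asboolP => /idealN; rewrite opprB.
- move=> /asboolP xy /asboolP yz; apply/asboolP.
  by rewrite -[x](subrK y) -addrA; apply: idealD.
Qed.

Canonical ideal_equiv_equiv := EquivRelPack ideal_equiv_class.
Canonical ideal_equiv_encModRel := defaultEncModRel ideal_equiv.

Definition quot := {eq_quot ideal_equiv}.
HB.instance Definition _ : EqQuotient A ideal_equiv quot := EqQuotient.on quot.
HB.instance Definition _ := Choice.on quot.

Definition qpi (x : A) : quot := \pi x.

Lemma qpiP x y : qpi x = qpi y <-> I (x - y).
Proof.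
by split=> [/eqmodP/asboolP|xy] //; apply/eqmodP/asboolP.
Qed.

Lemma qreprK (x : quot) : qpi (repr x) = x.
Proof. exact: reprK. Qed.

Lemma repr_qpi x : I (repr (qpi x) - x).
Proof. by apply/qpiP; rewrite qreprK. Qed.

Definition qadd (x y : quot) := qpi (repr x + repr y).
Definition qopp (x : quot) := qpi (- repr x).
Definition qmul (x y : quot) := qpi (repr x * repr y).

Lemma qpiD x y : qadd (qpi x) (qpi y) = qpi (x + y).
Proof. by apply/qpiP; rewrite opprD addrACA; apply: idealD; apply: repr_qpi. Qed.

Lemma qpiN x : qopp (qpi x) = qpi (- x).
Proof. by apply/qpiP; rewrite -opprD; apply/idealN/repr_qpi. Qed.

Lemma qpiM x y : qmul (qpi x) (qpi y) = qpi (x * y).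
Proof.
apply/qpiP; set a := repr _; set b := repr _.
have -> : a * b - x * y = (a - x) * b + x * (b - y).
  by rewrite mulrBl mulrBr addrA subrK.
by apply: idealD; [apply/idealMr/repr_qpi|apply/idealMl/repr_qpi].
Qed.

Lemma quotW (P : quot -> Prop) : (forall x, P (qpi x)) -> forall x, P x.
Proof. by move=> H x; rewrite -[x]qreprK. Qed.

Lemma qaddA : associative qadd.
Proof. by do 3!elim/quotW=> ?; rewrite !qpiD addrA. Qed.
Lemma qaddC : commutative qadd.
Proof. by do 2!elim/quotW=> ?; rewrite !qpiD addrC. Qed.
Lemma qadd0 : left_id (qpi 0) qadd.
Proof. by elim/quotW=> ?; rewrite qpiD add0r. Qed.
Lemma qaddN : left_inverse (qpi 0) qopp qadd.
Proof. by elim/quotW=> ?; rewrite qpiN qpiD addNr. Qed.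

HB.instance Definition _ := GRing.isZmodule.Build quot qaddA qaddC qadd0 qaddN.

Lemma qmulA : associative qmul.
Proof. by do 3!elim/quotW=> ?; rewrite !qpiM mulrA. Qed.
Lemma qmul1 : left_id (qpi 1) qmul.
Proof. by elim/quotW=> ?; rewrite qpiM mul1r. Qed.
Lemma qmulr1 : right_id (qpi 1) qmul.
Proof. by elim/quotW=> ?; rewrite qpiM mulr1. Qed.
Lemma qpi_add x y : qpi x + qpi y = qpi (x + y).
Proof. exact: qpiD. Qed.
Lemma qmulDl : left_distributive qmul +%R.
Proof.
by do 3!elim/quotW=> ?; rewrite qpi_add !qpiM qpi_add mulrDl.
Qed.
Lemma qmulDr : right_distributive qmul +%R.
Proof.
by do 3!elim/quotW=> ?; rewrite qpi_add !qpiM qpi_add mulrDr.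
Qed.

HB.instance Definition _ := GRing.Zmodule_isPzRing.Build quot
  qmulA qmul1 qmulr1 qmulDl qmulDr.

Lemma qpi_zmod_morphism : zmod_morphism qpi.
Proof. by move=> x y; rewrite -qpi_add -qpiN. Qed.
Lemma qpi_monoid_morphism : GRing.monoid_morphism qpi.
Proof. by split=> // x y; rewrite -qpiM. Qed.

HB.instance Definition _ :=
  GRing.isZmodMorphism.Build A quot qpi qpi_zmod_morphism.
HB.instance Definition _ :=
  GRing.isMonoidMorphism.Build A quot qpi qpi_monoid_morphism.

Lemma qalgC (a : k) (x : quot) :
  (qpi \o @alg_map k A) a * x = x * (qpi \o @alg_map k A) a.
Proof. by elim/quotW: x => x /=; rewrite -!rmorphM alg_mapC. Qed.

HB.instance Definition _ :=
  isPzAlgebra.Build k quot qalgC.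

End Quotient.

Record filtration (A : pzRingType) := Filtration {
  filt :> nat -> ideal A;
  filt_decr : forall m x, filt m.+1 x -> filt m x
}.

Section Completion.
Variables (k : comPzRingType) (A : pzAlgType k) (F : filtration A).

(* the transition map A / F^(m+1) -> A / F^m *)
Definition qtrans m (x : quot (F m.+1)) : quot (F m) := qpi (F m) (repr x).

Lemma qtransE m x : qtrans (qpi (F m.+1) x) = qpi (F m) x.
Proof. by apply/qpiP/filt_decr/repr_qpi. Qed.

Record completion := Completion {
  cproj :> forall m, quot (F m);
  _ : forall m, qtrans (cproj m.+1) = cproj m
}.

HB.instance Definition _ := gen_eqMixin completion.
HB.instance Definition _ := gen_choiceMixin completion.

Lemma ctransE (x : completion) m : qtrans (x m.+1) = x m.
Proof. by case: x. Qed.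

Lemma completionP (x y : completion) : (forall m, x m = y m) -> x = y.
Proof.
case: x y => [x xP] [y yP] /= xy.
have E : x = y by apply: functional_extensionality_dep.
by subst y; congr Completion; apply: Prop_irrelevance.
Qed.

Lemma qtransD m : {morph @qtrans m : x y / x + y}.
Proof.
by move=> x y; elim/quotW: x => x; elim/quotW: y => y;
  rewrite -rmorphD !qtransE rmorphD.
Qed.
Lemma qtransN m : {morph @qtrans m : x / - x}.
Proof. by elim/quotW=> x; rewrite -rmorphN !qtransE rmorphN. Qed.
Lemma qtransM m : {morph @qtrans m : x y / x * y}.
Proof.
by move=> x y; elim/quotW: x => x; elim/quotW: y => y;
  rewrite -rmorphM !qtransE rmorphM.
Qed.
Definition of_alg (a : A) : completion :=
  @Completion (fun m => qpi (F m) a) (fun m => qtransE m a).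

Definition cadd (x y : completion) : completion.
Proof. by exists (fun m => x m + y m) => m; rewrite qtransD !ctransE. Defined.
Definition copp (x : completion) : completion.
Proof. by exists (fun m => - x m) => m; rewrite qtransN !ctransE. Defined.
Definition cmul (x y : completion) : completion.
Proof. by exists (fun m => x m * y m) => m; rewrite qtransM !ctransE. Defined.
Lemma caddA : associative cadd.
Proof. by move=> x y z; apply: completionP => m; apply: addrA. Qed.
Lemma caddC : commutative cadd.
Proof. by move=> x y; apply: completionP => m; apply: addrC. Qed.
Lemma cadd0 : left_id (of_alg 0) cadd.
Proof. by move=> x; apply: completionP => m; apply: add0r. Qed.
Lemma caddN : left_inverse (of_alg 0) copp cadd.
Proof. by move=> x; apply: completionP => m; apply: addNr. Qed.

HB.instance Definition _ := GRing.isZmodule.Build completion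
  caddA caddC cadd0 caddN.

Lemma cmulA : associative cmul.
Proof. by move=> x y z; apply: completionP => m; apply: mulrA. Qed.
Lemma cmul1 : left_id (of_alg 1) cmul.
Proof. by move=> x; apply: completionP => m; apply: mul1r. Qed.
Lemma cmulr1 : right_id (of_alg 1) cmul.
Proof. by move=> x; apply: completionP => m; apply: mulr1. Qed.
Lemma cmulDl : left_distributive cmul +%R.
Proof. by move=> x y z; apply: completionP => m; apply: mulrDl. Qed.
Lemma cmulDr : right_distributive cmul +%R.
Proof. by move=> x y z; apply: completionP => m; apply: mulrDr. Qed.

HB.instance Definition _ := GRing.Zmodule_isPzRing.Build completion
  cmulA cmul1 cmulr1 cmulDl cmulDr.

Lemma of_alg_zmod_morphism : zmod_morphism of_alg.
Proof. by move=> x y; apply: completionP => m; apply: rmorphB. Qed.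
Lemma of_alg_monoid_morphism : GRing.monoid_morphism of_alg.
Proof. by split=> // x y; apply: completionP => m; apply: rmorphM. Qed.

HB.instance Definition _ :=
  GRing.isZmodMorphism.Build A completion of_alg of_alg_zmod_morphism.
HB.instance Definition _ :=
  GRing.isMonoidMorphism.Build A completion of_alg of_alg_monoid_morphism.

Lemma calgC (a : k) (x : completion) :
  (of_alg \o @alg_map k A) a * x = x * (of_alg \o @alg_map k A) a.
Proof. by apply: completionP => m; apply: (alg_mapC a (x m)). Qed.

HB.instance Definition _ :=
  isPzAlgebra.Build k completion calgC.

(* The m-th step of the filtration of the completion is the kernel of its
   projection to A / F^m. *)
Definition cfilt m : set completion := [set x | x m = 0].

Definition cnbhs (x : completion) : set_system completion :=
  [set U | exists m, forall y, cfilt m (y - x) -> U y].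

Lemma cfiltS m : cfilt m.+1 `<=` cfilt m.
Proof.
move=> x; rewrite /cfilt /= -[x m]ctransE => ->.
exact: (qtransE m 0).
Qed.

Lemma cfilt_le m n : (m <= n)%N -> cfilt n `<=` cfilt m.
Proof.
move=> /subnK <-; elim: (n - m)%N => // d IH x.
by rewrite addSn => /cfiltS /IH.
Qed.

Lemma cnbhs_filter (x : completion) : ProperFilter (cnbhs x).
Proof.
have x0 m : cfilt m (x - x) by rewrite subrr.
split; first by move=> [m mP]; apply: (mP x).
split.
- by exists 0%N.
- move=> P Q [m mP] [n nQ]; exists (maxn m n) => y yx; split.
    by apply: mP; apply: cfilt_le yx; apply: leq_maxl.
  by apply: nQ; apply: cfilt_le yx; apply: leq_maxr.
- by move=> P Q PQ [m mP]; exists m => y /mP /PQ.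
Qed.

Lemma cnbhs_singleton (x : completion) (U : set completion) : cnbhs x U -> U x.
Proof. by move=> [m]; apply; rewrite subrr. Qed.

Lemma cnbhs_nbhs (x : completion) (U : set completion) :
  cnbhs x U -> cnbhs x (cnbhs^~ U).
Proof.
move=> [m mU]; exists m => y yx; exists m => z zy; apply: mU.
have -> : z - x = (z - y) + (y - x) by rewrite addrA subrK.
by rewrite /cfilt /= -[LHS]/((z - y) m + (y - x) m) zy yx addr0.
Qed.

HB.instance Definition _ := hasNbhs.Build completion cnbhs.
HB.instance Definition _ := isPointed.Build completion (0 : completion).
HB.instance Definition _ := Nbhs_isNbhsTopological.Build completion
  cnbhs_filter cnbhs_singleton cnbhs_nbhs.

(* exp x is the limit of its partial sums, the rational coefficients 1/n! being
   mapped to k by u. *)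
Definition cexp (u : {rmorphism rat -> k}) (x : completion) : completion :=
  limn (fun n : nat => \sum_(i < n) alg_map (u (i`!%:R^-1)) * x ^+ i).

End Completion.

Definition topalg_iso (k : comPzRingType) (A B : pzAlgType k)
    (F : filtration A) (F' : filtration B)
    (f : completion F -> completion F') : Prop :=
  [/\ {morph f : x y / x + y}, GRing.monoid_morphism f,
      forall a : k, f (alg_map a) = alg_map a
    & exists g : completion F' -> completion F,
        [/\ cancel f g, cancel g f, continuous f & continuous g]].

(* The ring structure that the library puts on {malg k[M]} is restricted to
   monoids without nontrivial units, which excludes groups. *)
Definition monoid_alg (k : comPzRingType) (M : monoidType) : Type :=
  {malg k[M]}.

Section MonoidAlgebra.
Variables (k : comPzRingType) (M : monoidType).

HB.instance Definition _ := GRing.Zmodule.on (monoid_alg k M).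

Local Notation MA := (monoid_alg k M).
Implicit Types g : MA.

Definition ma_one : MA := << 1 *g 1%g >>.

Definition ma_mul g1 g2 : MA :=
  \sum_(x <- msupp g1) \sum_(y <- msupp g2) << g1@_x * g2@_y *g (x * y)%g >>.

Lemma ma_mulw (d1 d2 : {fset M}) g1 g2 :
  (msupp g1 `<=` d1)%fset -> (msupp g2 `<=` d2)%fset ->
  ma_mul g1 g2 =
  \sum_(x <- d1) \sum_(y <- d2) << g1@_x * g2@_y *g (x * y)%g >>.
Proof.
move=> le1 le2; rewrite /ma_mul (big_fset_incl _ le1) /=.
  apply/eq_bigr=> x _; apply/big_fset_incl => // y _ /mcoeff_outdom ->.
  by rewrite mulr0 monalgU0.
move=> x _ /mcoeff_outdom g1x.
by rewrite big1 => // y _; rewrite g1x mul0r monalgU0.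
Qed.

Lemma ma_mulDl : left_distributive ma_mul +%R.
Proof.
move=> g1 g2 g; set d := (msupp g1 `|` msupp g2)%fset.
have sub0 := fsubset_refl (msupp g).
rewrite (ma_mulw (msuppD_le _ _ : _ `<=` d)%fset sub0).
rewrite (ma_mulw (fsubsetUl _ _ : _ `<=` d)%fset sub0).
rewrite (ma_mulw (fsubsetUr _ _ : _ `<=` d)%fset sub0).
rewrite -big_split /=; apply/eq_bigr=> x _.
rewrite -big_split /=; apply/eq_bigr=> y _.
by rewrite mcoeffD mulrDl monalgUD.
Qed.

Lemma ma_mulDr : right_distributive ma_mul +%R.
Proof.
move=> g g1 g2; set d := (msupp g1 `|` msupp g2)%fset.
have sub0 := fsubset_refl (msupp g).
rewrite (ma_mulw sub0 (msuppD_le _ _ : _ `<=` d)%fset).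
rewrite (ma_mulw sub0 (fsubsetUl _ _ : _ `<=` d)%fset).
rewrite (ma_mulw sub0 (fsubsetUr _ _ : _ `<=` d)%fset).
rewrite -big_split /=; apply/eq_bigr=> x _.
rewrite -big_split /=; apply/eq_bigr=> y _.
by rewrite mcoeffD mulrDr monalgUD.
Qed.

Lemma ma_mul0g : left_zero 0 ma_mul.
Proof. by move=> g; rewrite /ma_mul msupp0 big_seq_fset0. Qed.

Lemma ma_mulg0 : right_zero 0 ma_mul.
Proof. by move=> g; rewrite /ma_mul big1 // => x _; rewrite msupp0 big_seq_fset0. Qed.

Lemma ma_mulUU a b x y :
  ma_mul << a *g x >> << b *g y >> = << a * b *g (x * y)%g >>.
Proof. by rewrite (ma_mulw msuppU_le msuppU_le) !big_seq_fset1 !mcoeffUU. Qed.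

Lemma ma_ind (P : MA -> Prop) :
  P 0 -> (forall a x, P << a *g x >>) -> (forall g h, P g -> P h -> P (g + h)) ->
  forall g, P g.
Proof. by move=> P0 PU PD g; rewrite [g]monalgE; elim/big_ind: _. Qed.

Lemma ma_mulA : associative ma_mul.
Proof.
elim/ma_ind => [|a x|g g' IH IH'] h l; first by rewrite !ma_mul0g.
  elim/ma_ind: h l => [|b y|h h' IH IH'] l.
  - by rewrite ma_mulg0 !ma_mul0g ma_mulg0.
  - elim/ma_ind: l => [|c z|l l' IH IH']; first by rewrite !ma_mulg0.
      by rewrite !ma_mulUU mulrA mulgA.
    by rewrite !ma_mulDr IH IH'.
  - by rewrite ma_mulDr !ma_mulDl ma_mulDr IH IH'.
by rewrite !ma_mulDl IH IH'.
Qed.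

Lemma ma_mul1g : left_id ma_one ma_mul.
Proof.
elim/ma_ind => [|a x|g h IH IH']; first by rewrite ma_mulg0.
  by rewrite ma_mulUU mul1r mul1g.
by rewrite ma_mulDr IH IH'.
Qed.

Lemma ma_mulg1 : right_id ma_one ma_mul.
Proof.
elim/ma_ind => [|a x|g h IH IH']; first by rewrite ma_mul0g.
  by rewrite ma_mulUU mulr1 mulg1.
by rewrite ma_mulDl IH IH'.
Qed.

HB.instance Definition _ := GRing.Zmodule_isPzRing.Build MA
  ma_mulA ma_mul1g ma_mulg1 ma_mulDl ma_mulDr.

Definition ma_const (a : k) : MA := << a *g 1%g >>.

Lemma ma_const_zmod_morphism : zmod_morphism ma_const.
Proof. by move=> a b; rewrite /ma_const monalgUB. Qed.
Lemma ma_const_monoid_morphism : GRing.monoid_morphism ma_const.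
Proof. by split=> // a b; rewrite [RHS]ma_mulUU mulg1. Qed.

HB.instance Definition _ :=
  GRing.isZmodMorphism.Build k MA ma_const ma_const_zmod_morphism.
HB.instance Definition _ :=
  GRing.isMonoidMorphism.Build k MA ma_const ma_const_monoid_morphism.

Lemma ma_constC (a : k) g : ma_const a * g = g * ma_const a.
Proof.
elim/ma_ind: g => [|b x|g h IH IH']; first by rewrite mulr0 mul0r.
  by rewrite [LHS]ma_mulUU [RHS]ma_mulUU mulrC mulg1 mul1g.
by rewrite mulrDr mulrDl IH IH'.
Qed.

HB.instance Definition _ := isPzAlgebra.Build k MA ma_constC.

Definition ma_of (x : M) : MA := << 1 *g x >>.

End MonoidAlgebra.

Section MonoidAlgebraMap.
Variables (k : comPzRingType) (M M' : monoidType).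
Variable phi : UMagmaMorphism.type M M'.

Definition ma_map (g : monoid_alg k M) : monoid_alg k M' :=
  \sum_(x <- msupp g) << g@_x *g phi x >>.

Lemma ma_mapw (d : {fset M}) (g : monoid_alg k M) :
  (msupp g `<=` d)%fset -> ma_map g = \sum_(x <- d) << g@_x *g phi x >>.
Proof.
move=> le; rewrite /ma_map (big_fset_incl _ le) // => x _ /mcoeff_outdom ->.
by rewrite monalgU0.
Qed.

Lemma ma_map_zmod_morphism : zmod_morphism ma_map.
Proof.
move=> g h; set d := (msupp g `|` msupp h)%fset.
rewrite (ma_mapw (msuppB_le _ _ : _ `<=` d)%fset).
rewrite (ma_mapw (fsubsetUl _ _ : _ `<=` d)%fset).
rewrite (ma_mapw (fsubsetUr _ _ : _ `<=` d)%fset).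
by rewrite -sumrB; apply/eq_bigr => x _; rewrite mcoeffB monalgUB.
Qed.

HB.instance Definition _ := GRing.isZmodMorphism.Build
  (monoid_alg k M) (monoid_alg k M') ma_map ma_map_zmod_morphism.

Lemma ma_mapU a x : ma_map << a *g x >> = << a *g phi x >>.
Proof. by rewrite (ma_mapw msuppU_le) big_seq_fset1 mcoeffUU. Qed.

Lemma ma_map_monoid_morphism : GRing.monoid_morphism ma_map.
Proof.
split=> [|g h]; first by rewrite [LHS]ma_mapU gmulf1.
elim/ma_ind: g => [|a x|g g' IH IH']; first by rewrite mul0r raddf0 mul0r.
  elim/ma_ind: h => [|b y|h h' IH IH']; first by rewrite mulr0 raddf0 mulr0.
    by rewrite [_ * _]ma_mulUU !ma_mapU [RHS]ma_mulUU gmulfM.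
  by rewrite mulrDr !raddfD /= IH IH' mulrDr.
by rewrite mulrDl !raddfD /= IH IH' mulrDl.
Qed.

HB.instance Definition _ := GRing.isMonoidMorphism.Build
  (monoid_alg k M) (monoid_alg k M') ma_map ma_map_monoid_morphism.

End MonoidAlgebraMap.

Definition words (T : Type) : Type := seq T.

Section FreeMonoid.
Variable T : choiceType.

HB.instance Definition _ := Choice.on (words T).
HB.instance Definition _ := isMonoid.Build (words T) (@catA T) (@cat0s T) (@cats0 T).

End FreeMonoid.

(* The elements of the free group on T are the reduced words in the letters
   (x, false) = x and (x, true) = x^-1. *)
Section FreeGroup.
Variable T : choiceType.

Local Notation letter := (T * bool)%type.

Definition linv (a : letter) : letter := (a.1, ~~ a.2).

Definition reduced (w : seq letter) : bool := sorted (fun a b => b != linv a) w.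

Record free_group := FreeGroup {
  fg_word : seq letter;
  fg_reduced : reduced fg_word
}.

HB.instance Definition _ := [isSub for fg_word].
HB.instance Definition _ := [Choice of free_group by <:].

(* the reduced form of a :: w, for w reduced *)
Definition lmul (a : letter) (w : seq letter) : seq letter :=
  if w is b :: w' then if b == linv a then w' else a :: w else [:: a].

Lemma linvK : involutive linv.
Proof. by case=> x b; rewrite /linv /= negbK. Qed.

Lemma reduced_lmul a w : reduced w -> reduced (lmul a w).
Proof.
case: w => [//|b w] /= bw; case: eqP => [_|/eqP ba]; first exact: path_sorted bw.
by rewrite /= ba.
Qed.

Lemma reduced_foldr u w : reduced w -> reduced (foldr lmul w u).
Proof. by move=> rw; elim: u => //= a u IH; apply: reduced_lmul. Qed.

Lemma lmulK a w : reduced w -> lmul (linv a) (lmul a w) = w.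
Proof.
case: w => [_|b w] /=; first by rewrite linvK eqxx.
case: (eqVneq b (linv a)) => [-> |ba bw] /=; last by rewrite linvK eqxx.
by case: w => [//|c w] /= /andP[/negPf -> _].
Qed.

Lemma foldr_lmul a v w : reduced w ->
  foldr lmul w (lmul a v) = lmul a (foldr lmul w v).
Proof.
case: v => [//|b v] rw /=; case: eqP => [->|//].
by rewrite -{1}[a]linvK lmulK //; apply: reduced_foldr.
Qed.

Lemma foldr_reduced w : reduced w -> foldr lmul [::] w = w.
Proof.
elim: w => [//|a w IH] /= aw; rewrite IH; last exact: path_sorted aw.
by case: w aw {IH} => [//|b w] /= /andP[/negPf ->].
Qed.

Lemma foldr_rev w v : reduced v ->
  foldr lmul (foldr lmul v w) (rev (map linv w)) = v.
Proof.
move=> rv; elim: w => [//|a w IH] /=.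
by rewrite rev_cons -cats1 foldr_cat /= lmulK ?IH //; apply: reduced_foldr.
Qed.

Lemma reduced_rev w : reduced w -> reduced (rev (map linv w)).
Proof.
rewrite /reduced rev_sorted sorted_map; apply: sub_sorted => a b /=.
by apply: contra => /eqP ->; rewrite linvK.
Qed.

Definition fg_one : free_group := @FreeGroup [::] isT.
Definition fg_mul (u v : free_group) : free_group :=
  FreeGroup (reduced_foldr (fg_word u) (fg_reduced v)).
Definition fg_inv (u : free_group) : free_group :=
  FreeGroup (reduced_rev (fg_reduced u)).

Lemma fg_mulA : associative fg_mul.
Proof.
move=> u v w; apply: val_inj => /=; elim: (fg_word u) => [//|a s IH] /=.
by rewrite IH foldr_lmul //; apply: fg_reduced.
Qed.
Lemma fg_mul1 : left_id fg_one fg_mul.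
Proof. by move=> u; apply: val_inj. Qed.
Lemma fg_mulr1 : right_id fg_one fg_mul.
Proof. by move=> u; apply: val_inj => /=; apply/foldr_reduced/fg_reduced. Qed.
Lemma fg_mulV : left_inverse fg_one fg_inv fg_mul.
Proof.
move=> u; apply: val_inj => /=.
by rewrite -{1}[fg_word u]foldr_reduced ?fg_reduced // foldr_rev.
Qed.
Lemma fg_invK : involutive fg_inv.
Proof.
move=> u; apply: val_inj => /=.
by rewrite map_rev revK -map_comp -[RHS]map_id; apply: eq_map => a; apply: linvK.
Qed.
Lemma fg_mulrV : right_inverse fg_one fg_inv fg_mul.
Proof. by move=> u; rewrite -{1}[u]fg_invK fg_mulV. Qed.

HB.instance Definition _ := isGroup.Build free_group
  fg_mulA fg_mul1 fg_mulr1 fg_mulV fg_mulrV.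

Definition fg_gen (x : T) : free_group := @FreeGroup [:: (x, false)] isT.

Section Lift.
Variables (H : groupType) (f : T -> H).

Definition fg_lift_letter (a : letter) : H :=
  if a.2 then (f a.1)^-1%g else f a.1.

Definition fg_lift (u : free_group) : H :=
  foldr (fun a h => fg_lift_letter a * h)%g 1%g (fg_word u).

Lemma fg_lift_letterV a : (fg_lift_letter a * fg_lift_letter (linv a))%g = 1%g.
Proof. by case: a => x []; rewrite /fg_lift_letter /= ?mulVg ?mulgV. Qed.

Lemma fg_lift_monoid_morphism : monoid.monoid_morphism fg_lift.
Proof.
split=> // u v; rewrite /fg_lift /=.
elim: (fg_word u) => [|a s IH] /=; first by rewrite mul1g.
rewrite -mulgA -{}IH; move: (foldr lmul _ s) => w.
case: w => [//|b w] /=; case: eqP => [->|//].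
by rewrite mulgA fg_lift_letterV mul1g.
Qed.

HB.instance Definition _ :=
  isUMagmaMorphism.Build free_group H fg_lift fg_lift_monoid_morphism.

End Lift.
End FreeGroup.

Section RootsOfUnity.
Variables (R : realType) (N : nat).

(* e^(2 pi i / N) *)
Definition zeta : R[i] := (cos (2 * pi / N%:R) +i* sin (2 * pi / N%:R))%C.

Record mu := Mu {
  mu_val : R[i];
  muP : (mu_val != 0) && (mu_val ^+ N == 1)
}.

HB.instance Definition _ := [isSub for mu_val].
HB.instance Definition _ := [Choice of mu by <:].

Lemma mu1P : ((1 : R[i]) != 0) && ((1 : R[i]) ^+ N == 1).
Proof. by rewrite oner_eq0 expr1n eqxx. Qed.
Lemma muMP (x y : mu) :
  (mu_val x * mu_val y != 0) && ((mu_val x * mu_val y) ^+ N == 1).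
Proof.
case: x y => [x /andP[x0 /eqP xN]] [y /andP[y0 /eqP yN]] /=.
by rewrite mulf_neq0 //= exprMn xN yN mulr1.
Qed.
Lemma muVP (x : mu) : ((mu_val x)^-1 != 0) && ((mu_val x)^-1 ^+ N == 1).
Proof. by case: x => [x /andP[x0 /eqP xN]] /=; rewrite invr_eq0 x0 exprVn xN invr1 /=. Qed.

Definition mu_one : mu := Mu mu1P.
Definition mu_mul (x y : mu) : mu := Mu (muMP x y).
Definition mu_inv (x : mu) : mu := Mu (muVP x).

Lemma mu_mulA : associative mu_mul.
Proof. by move=> x y z; apply: val_inj; apply: mulrA. Qed.
Lemma mu_mul1 : left_id mu_one mu_mul.
Proof. by move=> x; apply: val_inj; apply: mul1r. Qed.
Lemma mu_mulr1 : right_id mu_one mu_mul.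
Proof. by move=> x; apply: val_inj; apply: mulr1. Qed.
Lemma mu_mulV : left_inverse mu_one mu_inv mu_mul.
Proof.
by move=> x; apply: val_inj; case: x => x /= /andP[x0 _]; apply: mulVf.
Qed.
Lemma mu_mulrV : right_inverse mu_one mu_inv mu_mul.
Proof.
by move=> x; apply: val_inj; case: x => x /= /andP[x0 _]; apply: mulfV.
Qed.

HB.instance Definition _ := isGroup.Build mu
  mu_mulA mu_mul1 mu_mulr1 mu_mulV mu_mulrV.

Lemma cos_sinX (t : R) n :
  (cos t +i* sin t)%C ^+ n = (cos (t *+ n) +i* sin (t *+ n))%C.
Proof.
elim: n => [|n IH]; first by rewrite expr0 mulr0n cos0 sin0.
rewrite exprS IH mulrS cosD sinD; apply/eqP.
by rewrite eq_complex /= eqxx /= addrC eqxx.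
Qed.

Lemma zetaP : (zeta != 0) && (zeta ^+ N == 1).
Proof.
apply/andP; split.
  rewrite /zeta eq_complex /= negb_and; case: eqP => //= c0.
  apply/eqP => s0; have := cos2Dsin2 (2 * pi / N%:R : R).
  by rewrite c0 s0 expr0n addr0 => /esym/eqP; rewrite oner_eq0.
rewrite cos_sinX; have [->|N0] := eqVneq N 0%N; first by rewrite mulr0n cos0 sin0.
by rewrite -(mulr_natr (_ / _)) divfK ?pnatr_eq0 // mulr_natl cos2pi sin2pi.
Qed.

Definition zeta_mu : mu := Mu zetaP.

End RootsOfUnity.

Section Betti.
Variables (R : realType) (k : comPzRingType) (N : nat).

(* free group on X_0 = fg_gen false and X_1 = fg_gen true *)
Definition F2 : groupType := free_group bool.

Definition VB : pzAlgType k := monoid_alg k F2.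

Definition F2_mu : F2 -> mu R N :=
  fg_lift (fun b : bool => if b then 1%g else zeta_mu R N).
HB.instance Definition _ := UMagmaMorphism.on F2_mu.

Definition VB_ideal : ideal VB :=
  ker_ideal (ma_map F2_mu : {rmorphism monoid_alg k F2 -> monoid_alg k (mu R N)}).

Definition VB_filt : filtration VB :=
  @Filtration _ (ideal_pow VB_ideal)
    (fun m => @ideal_mul_subr _ VB_ideal (ideal_pow VB_ideal m)).

Definition X0 : completion VB_filt := of_alg VB_filt (ma_of k (fg_gen false : F2)).
Definition X1 : completion VB_filt := of_alg VB_filt (ma_of k (fg_gen true : F2)).

End Betti.

Notation VBhat R k N := (completion (VB_filt R k N)).

Section DeRham.
Variables (k : comPzRingType) (gT : finGroupType).

(* generators: e_0 = inl false, e_1 = inl true, g = inr g for g in G *)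
Definition dr_gen : choiceType := (bool + gT)%type.

Definition dr_free : pzAlgType k := monoid_alg k (words dr_gen).

Definition letter (c : dr_gen) : dr_free := ma_of k ([:: c] : words dr_gen).

Inductive dr_rel : dr_free -> Prop :=
| dr_relM g h : dr_rel (letter (inr g) * letter (inr h) - letter (inr (g * h)%g))
| dr_rel1 : dr_rel (letter (inr 1%g) - 1)
| dr_relC g :
    dr_rel (letter (inr g) * letter (inl false) - letter (inl false) * letter (inr g)).

Definition VDR : pzAlgType k := quot (ideal_gen dr_rel).

Definition dr_deg (w : words dr_gen) : nat :=
  count (fun c => if c is inl _ then true else false) w.

Definition deg_ge (m : nat) (p : dr_free) : Prop :=
  forall w, w \in msupp p -> (m <= dr_deg w)%N.

(* the span of the classes of the words of degree at least m *)
Definition VDR_set (m : nat) (x : VDR) : Prop :=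
  exists2 p, deg_ge m p & x = qpi (ideal_gen dr_rel) p.

Lemma deg_geP m p : deg_ge m p <->
  forall w, (dr_deg w < m)%N -> p@_w = 0.
Proof.
split=> [h w lt|h w]; last by rewrite leqNgt -mcoeff_neq0; apply: contra_neqN => /h.
by apply/eqP; rewrite mcoeff_eq0; apply/negP => /h; rewrite leqNgt lt.
Qed.

Lemma deg_geB m p q : deg_ge m p -> deg_ge m q -> deg_ge m (p - q).
Proof.
by move=> /deg_geP pm /deg_geP qm; apply/deg_geP => w lt; rewrite mcoeffB pm ?qm ?subr0.
Qed.

Lemma deg_geM m n p q : deg_ge m p -> deg_ge n q -> deg_ge (m + n) (p * q).
Proof.
move=> pm qn; apply/deg_geP => w lt.
rewrite -[p * q]/(ma_mul p q) /ma_mul raddf_sum big_seq big1 //= => u /pm um.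
rewrite raddf_sum big_seq big1 //= => v /qn vn.
rewrite mcoeffU; case: eqP => // uv; move: lt.
by rewrite -uv /dr_deg count_cat ltnNge leq_add.
Qed.

Definition VDR_ideal (m : nat) : ideal VDR.
Proof.
exists (VDR_set m).
- by exists 0; [apply/deg_geP => w _; rewrite mcoeff0|rewrite rmorph0].
- move=> _ _ [p pm ->] [q qm ->]; exists (p - q); last by rewrite rmorphB.
  exact: deg_geB.
- move=> a _ [p pm ->]; exists (repr a * p); last by rewrite rmorphM /= qreprK.
  by rewrite -[m]add0n; apply: deg_geM.
- move=> _ a [p pm ->]; exists (p * repr a); last by rewrite rmorphM /= qreprK.
  by rewrite -[m]addn0; apply: deg_geM.
Defined.

Lemma VDR_decr m x : VDR_ideal m.+1 x -> VDR_ideal m x.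
Proof. by move=> [p pm ->]; exists p => // w /pm /ltnW. Qed.

Definition VDR_filt : filtration VDR := Filtration VDR_decr.

Definition dr_class (c : dr_gen) : completion VDR_filt :=
  of_alg VDR_filt (qpi (ideal_gen dr_rel) (letter c)).

Definition e0 : completion VDR_filt := dr_class (inl false).
Definition e1 : completion VDR_filt := dr_class (inl true).
Definition grp (g : gT) : completion VDR_filt := dr_class (inr g).

End DeRham.

Notation VDRhat k gT := (completion (VDR_filt k gT)).

Section Embedding.
Variables (R : realType) (gT : finGroupType).

Definition group_embedding (iota : gT -> R[i]) : Prop :=
  [/\ forall g, iota g \is a GRing.unit,
      {morph iota : g h / (g * h)%g >-> g * h} & injective iota].

(* iota^-1 (e^(2 pi i / N)); a preimage exists when iota is an embedding and
   #|G| = N *)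
Definition g_iota (N : nat) (iota : gT -> R[i]) : gT :=
  odflt 1%g [pick g | iota g == zeta R N].

End Embedding.

(* Main.v *)
Require Import Defs.
From HB Require Import structures.
From mathcomp Require Import all_boot all_order all_algebra fingroup cyclic.
From mathcomp Require Import complex.
From mathcomp Require Import boolp classical_sets reals topology trigo.
From mathcomp Require Import finmap generic_quotient monalg ring lra.

Set Implicit Arguments.
Unset Strict Implicit.
Unset Printing Implicit Defensive.

Import Order.TTheory GRing.Theory Num.Theory.
Local Open Scope ring_scope.

(** The morphism from the Betti to the de Rham side exists because the free group
maps to the units of the complete algebra, an exponential being invertible, and
because modulo degree 1 this map is the group algebra map induced by
$\mu_N\simeq G$, so that the augmentation-type ideal $\mathcal I$ lands in
degree at least 1 and $\mathcal I^m$ in degree at least $m$ ([VB_to_VDR_filt]).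

Its inverse sends $e_1$ to $\log X_1$, $e_0$ to $\log X_0^N$ and $g_\iota$ to
$X_0\exp(-\frac1N\log X_0^N)$ ([inverse_exists]).  This makes sense because $X_1$
and $X_0^N$ lie in $1+\mathcal I$, because the last element is an $N$-th root of
unity that commutes with $\log X_0^N$ ([log_splitting]), and because $g_\iota$
generates $G$ and has order exactly $N$, $e^{2\pi i/N}$ being a primitive root of
unity ([g_iota_order], [g_iota_gen]).  Filtered morphisms commute with exp and
log, so both composites fix the generators; being continuous, they are identities.
Uniqueness holds since the group algebra is dense and the completion separated
([continuous_ext]).

Here the logarithm is the inverse of exp, which is a bijection from $F^1$ onto
$1+F^1$ in the completion of any multiplicative filtration ([cexp_inj],
[cexp_surj]) because the map $x\mapsto\exp x-x$ raises the filtration step of a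
difference ([cexp_contraction]).  All identities between logarithms, including
their commutation with other elements, follow from the injectivity of exp. *)

(** * Algebra morphisms *)

Record algmor (k : comPzRingType) (A B : pzAlgType k) := AlgMor {
  algmor_fun :> {rmorphism A -> B};
  algmor_map : forall a : k, algmor_fun (alg_map a) = alg_map a
}.

(** * Coordinates of the completion *)

Section CompletionCoordinates.
Variables (k : comPzRingType) (A : pzAlgType k) (F : filtration A).
Implicit Types x y : completion F.

Definition ccoord m (x : completion F) : quot (F m) := x m.

Lemma ccoord_zmod_morphism m : zmod_morphism (ccoord m).
Proof. by []. Qed.
Lemma ccoord_monoid_morphism m : GRing.monoid_morphism (ccoord m).
Proof. by []. Qed.
HB.instance Definition _ m := GRing.isZmodMorphism.Build
  (completion F) (quot (F m)) (ccoord m) (ccoord_zmod_morphism m).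
HB.instance Definition _ m := GRing.isMonoidMorphism.Build
  (completion F) (quot (F m)) (ccoord m) (ccoord_monoid_morphism m).

Lemma ccoordD x y m : (x + y) m = x m + y m. Proof. by []. Qed.
Lemma ccoordB x y m : (x - y) m = x m - y m. Proof. by []. Qed.
Lemma ccoordN x m : (- x) m = - x m. Proof. by []. Qed.
Lemma ccoordM x y m : (x * y) m = x m * y m. Proof. by []. Qed.
Lemma ccoordX x n m : (x ^+ n) m = x m ^+ n.
Proof. exact: (rmorphXn (ccoord m)). Qed.
Lemma ccoord_sum n (G : nat -> completion F) m :
  (\sum_(i < n) G i) m = \sum_(i < n) G i m.
Proof. exact: (raddf_sum (ccoord m)). Qed.

Lemma cfiltBP x y m : cfilt m (x - y) <-> x m = y m.
Proof.
rewrite -[cfilt _ _]/((x - y) m = 0) ccoordB.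
by split=> [/eqP|->]; rewrite ?subrr // subr_eq0 => /eqP.
Qed.

Lemma ccoord_le x y m n : (m <= n)%N -> x n = y n -> x m = y m.
Proof. by move=> mn /cfiltBP xy; apply/cfiltBP; apply: (cfilt_le mn). Qed.

Lemma of_alg_dense x m : exists a, of_alg F a m = x m.
Proof. by exists (repr (x m)); apply: qreprK. Qed.

Lemma of_alg_coord0 a m : of_alg F a m = 0 <-> F m a.
Proof.
rewrite -[X in F m X]subr0; exact: (qpiP (F m) a 0).
Qed.

End CompletionCoordinates.

Section FilteredMaps.
Variables (k : comPzRingType) (A B : pzAlgType k).
Variables (F : filtration A) (F' : filtration B).

Definition filtered (f : completion F -> completion F') :=
  forall m (x y : completion F), x m = y m -> f x m = f y m.

Lemma filtered_continuous f : filtered f -> continuous f.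
Proof.
move=> ff x U [m mU]; exists m => y yx; apply: mU.
by apply/cfiltBP/ff/cfiltBP.
Qed.

Lemma continuous_coord (f : completion F -> completion F') (x : completion F) m :
  continuous f -> exists n, forall y : completion F, y n = x n -> f y m = f x m.
Proof.
move=> /(_ x (fun y : completion F' => y m = f x m)) [].
  by exists m => y /cfiltBP.
by move=> n nP; exists n => y yx; apply: nP; apply/cfiltBP.
Qed.

(** A continuous map is determined by the dense subalgebra of constant
sequences, as the topology of the target is Hausdorff. *)
Lemma continuous_ext (f g : completion F -> completion F') : continuous f -> continuous g ->
  (forall a, f (of_alg F a) = g (of_alg F a)) -> f =1 g.
Proof.
move=> cf cg fg x; apply: completionP => m.
have [n1 fP] := continuous_coord x m cf.
have [n2 gP] := continuous_coord x m cg.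
have [a ax] := of_alg_dense x (maxn n1 n2).
rewrite -(fP (of_alg F a)) -?(gP (of_alg F a)) ?fg //.
  exact: ccoord_le (leq_maxr _ _) ax.
exact: ccoord_le (leq_maxl _ _) ax.
Qed.

(** A morphism that respects the filtrations extends to the completion, because its
$m$-th coordinate depends only on the class of the argument modulo $F^m$. *)
Section Extension.
Variables (phi : algmor A (completion F')).
Hypothesis phiF : forall m a, F m a -> phi a m = 0.

Lemma ext_coord (x : completion F) a m :
  of_alg F a m = x m -> phi (repr (x m)) m = phi a m.
Proof.
move=> <-; apply/eqP; rewrite -subr_eq0 -ccoordB -rmorphB; apply/eqP/phiF.
exact: repr_qpi.
Qed.

Definition ext (x : completion F) : completion F'.
Proof.
exists (fun m => phi (repr (x m)) m) => m; rewrite ctransE.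
apply/esym/ext_coord; apply: (@ccoord_le _ _ _ _ _ _ m.+1) => //.
exact: qreprK.
Defined.

Lemma extE (x : completion F) a m : of_alg F a m = x m -> ext x m = phi a m.
Proof. exact: ext_coord. Qed.

Lemma ext_filtered : filtered ext.
Proof.
by move=> m x y xy; have [a ax] := of_alg_dense x m;
  rewrite (extE ax) (@extE y a) // -xy.
Qed.

Lemma ext_of_alg a : ext (of_alg F a) = phi a.
Proof. by apply: completionP => m; apply: extE. Qed.

Lemma ext_zmod_morphism : zmod_morphism ext.
Proof.
move=> x y; apply: completionP => m; rewrite ccoordB.
have [a ax] := of_alg_dense x m; have [b bx] := of_alg_dense y m.
rewrite (extE ax) (extE bx) (@extE _ (a - b)) ?rmorphB //.
by rewrite ccoordB ax bx.
Qed.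
Lemma ext_monoid_morphism : GRing.monoid_morphism ext.
Proof.
split; first by rewrite -[1]/(of_alg F 1) ext_of_alg rmorph1.
move=> x y; apply: completionP => m; rewrite ccoordM.
have [a ax] := of_alg_dense x m; have [b bx] := of_alg_dense y m.
rewrite (extE ax) (extE bx) (@extE _ (a * b)) ?rmorphM //.
by rewrite !ccoordM ax bx.
Qed.
HB.instance Definition _ := GRing.isZmodMorphism.Build
  (completion F) (completion F') ext ext_zmod_morphism.
HB.instance Definition _ := GRing.isMonoidMorphism.Build
  (completion F) (completion F') ext ext_monoid_morphism.

Lemma ext_alg a : ext (alg_map a) = alg_map a.
Proof. by rewrite ext_of_alg algmor_map. Qed.

Definition ext_algmor := AlgMor ext_alg.

End Extension.
End FilteredMaps.

(** * The exponential of a complete filtered algebra *)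

Definition filt_mult (A : pzRingType) (F : filtration A) : Prop :=
  F 0%N 1 /\ forall m n x y, F m x -> F n y -> F (m + n)%N (x * y).

Definition exp_trunc (k : comPzRingType) (A : pzAlgType k)
    (u : {rmorphism rat -> k}) n (x : A) : A :=
  \sum_(i < n) alg_map (u (i`!%:R^-1)) * x ^+ i.

(** The evaluation at a nilpotent element of the rational polynomials is a ring
morphism that sees only finitely many coefficients; this reduces the functional
equation of the exponential to the binomial formula in $\mathbb Q$. *)
Section NilpotentEvaluation.
Variables (k : comPzRingType) (u : {rmorphism rat -> k}) (A : pzAlgType k).
Variables (x : A) (m : nat).
Hypothesis xm : x ^+ m = 0.
Implicit Types p q : {poly rat}.

Definition nil_eval (p : {poly rat}) : A := \sum_(i < m) alg_map (u p`_i) * x ^+ i.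

Lemma eq_nil_eval p q : (forall i, (i < m)%N -> p`_i = q`_i) ->
  nil_eval p = nil_eval q.
Proof. by move=> pq; apply: eq_bigr => i _; rewrite pq. Qed.

Lemma nil_evalD p q : nil_eval (p + q) = nil_eval p + nil_eval q.
Proof.
by rewrite -big_split; apply: eq_bigr => i _; rewrite coefD !rmorphD mulrDl.
Qed.

Lemma nil_evalMX p : nil_eval (p * 'X) = nil_eval p * x.
Proof.
rewrite /nil_eval; case: m xm => [|n] xn; first by rewrite !big_ord0 mul0r.
rewrite big_ord_recl big_ord_recr coefMX eqxx !rmorph0 mul0r add0r mulrDl.
rewrite -[X in _ = _ + X]mulrA -exprSr xn mulr0 addr0 mulr_suml.
by apply: eq_bigr => i _; rewrite coefMX /= exprSr mulrA.
Qed.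

Lemma nil_evalMC p c : nil_eval (p * c%:P) = nil_eval p * alg_map (u c).
Proof.
rewrite /nil_eval mulr_suml; apply: eq_bigr => i _.
by rewrite coefMC !rmorphM -!mulrA (alg_mapC (u c)).
Qed.

Lemma nil_evalM p q : nil_eval (p * q) = nil_eval p * nil_eval q.
Proof.
have nil_eval1 : nil_eval 1 = 1.
  rewrite /nil_eval; case: m xm => [|n] xn; first by rewrite big_ord0 -xn expr0.
  rewrite big_ord_recl coefC eqxx !rmorph1 expr0 mulr1 big1 ?addr0 // => i _.
  by rewrite coefC /= !rmorph0 mul0r.
have nil_evalC c : nil_eval c%:P = alg_map (u c).
  by rewrite -[c%:P]mul1r nil_evalMC nil_eval1 mul1r.
elim/poly_ind: q => [|q c IH].
  by rewrite mulr0 -[0]/(0%:P) nil_evalC !rmorph0 mulr0.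
by rewrite mulrDr mulrA !nil_evalD !nil_evalMX IH nil_evalMC nil_evalC mulrDr mulrA.
Qed.

Lemma exp_truncD a b :
  exp_trunc u m (alg_map (u a) * x) * exp_trunc u m (alg_map (u b) * x) =
  exp_trunc u m (alg_map (u (a + b)) * x).
Proof.
pose E c : {poly rat} := \poly_(i < m) (c ^+ i / i`!%:R).
have EE c : exp_trunc u m (alg_map (u c) * x) = nil_eval (E c).
  apply: eq_bigr => i _; rewrite coef_poly ltn_ord exprMn_comm; last exact: alg_mapC.
  by rewrite mulrA -!rmorphXn -!rmorphM mulrC.
rewrite !EE -nil_evalM; apply: eq_nil_eval => i im.
rewrite coefM coef_poly im addrC exprDn mulr_suml; apply: eq_bigr => j _.
have ji : (j <= i)%N by rewrite -ltnS.
rewrite !coef_poly (leq_ltn_trans ji im) (leq_ltn_trans (leq_subr _ _) im).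
have f0 n : n`!%:R != 0 :> rat by rewrite pnatr_eq0 -lt0n fact_gt0.
rewrite -mulr_natr -(bin_fact ji) !natrM.
have C0 : 'C(i, j)%:R != 0 :> rat by rewrite pnatr_eq0 -lt0n bin_gt0.
by field; rewrite C0 !f0.
Qed.

End NilpotentEvaluation.

Section Exponential.
Variables (k : comPzRingType) (u : {rmorphism rat -> k}).
Variables (A : pzAlgType k) (F : filtration A).
Hypothesis Fmul : filt_mult F.
Implicit Types x y z : completion F.

Lemma coordM_eq0 m n x y : x m = 0 -> y n = 0 -> (x * y) (m + n)%N = 0.
Proof.
move=> xm yn; have [a ax] := of_alg_dense x (m + n); have [b bx] := of_alg_dense y (m + n).
rewrite ccoordM -ax -bx -ccoordM -rmorphM; apply/of_alg_coord0/(proj2 Fmul).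
- by apply/of_alg_coord0; rewrite (ccoord_le _ ax) // leq_addr.
- by apply/of_alg_coord0; rewrite (ccoord_le _ bx) // leq_addl.
Qed.

Lemma coord0_all x : x 0%N = 0.
Proof.
have H : (1 : completion F) 0%N = 0 by apply/of_alg_coord0/(proj1 Fmul).
by rewrite -[x]mul1r ccoordM H mul0r.
Qed.

Lemma coord_eq0_le m n x : (m <= n)%N -> x n = 0 -> x m = 0.
Proof. by move=> mn x0; rewrite (@ccoord_le _ _ _ x 0 _ _ mn). Qed.

Lemma coordX_eq0 x m i : x 1%N = 0 -> (m <= i)%N -> (x ^+ i) m = 0.
Proof.
move=> x1 mi; apply: coord_eq0_le mi _; elim: i => [|i IH]; first exact: coord0_all.
by rewrite exprS -add1n; apply: coordM_eq0.
Qed.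

Lemma exp_trunc_coord n x m : exp_trunc u n x m = exp_trunc u n (x m).
Proof.
rewrite /exp_trunc (ccoord_sum n (fun i => alg_map (u i`!%:R^-1) * x ^+ i)).
by apply: eq_bigr => i _; rewrite ccoordM ccoordX.
Qed.

Lemma exp_trunc_stable x m n : x 1%N = 0 -> (m <= n)%N ->
  exp_trunc u n x m = exp_trunc u m x m.
Proof.
move=> x1 /subnKC <-; elim: (n - m)%N => [|d IH]; first by rewrite addn0.
have -> : exp_trunc u (m + d.+1) x = exp_trunc u (m + d) x +
    alg_map (u ((m + d)`!%:R^-1)) * x ^+ (m + d).
  by rewrite addnS /exp_trunc big_ord_recr.
rewrite ccoordD IH.
by rewrite ccoordM (coordX_eq0 x1 (leq_addr _ _)) mulr0 addr0.
Qed.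

Lemma completion_hausdorff : hausdorff_space (completion F).
Proof.
move=> p q pq; apply: completionP => m.
have [||y [py qy]] := pq (fun y => y m = p m) (fun y => y m = q m).
- by exists m => y /cfiltBP.
- by exists m => y /cfiltBP.
by rewrite -py.
Qed.

(** Each coordinate of the partial sums is eventually constant, so the exponential
is computed in $A/F^m$ by a finite sum. *)
Lemma cexp_coord x m n : x 1%N = 0 -> (m <= n)%N ->
  cexp u x m = exp_trunc u n x m.
Proof.
move=> x1 mn.
have lP m' : qtrans (exp_trunc u m'.+1 x m'.+1) = exp_trunc u m' x m'.
  by rewrite ctransE exp_trunc_stable.
pose l : completion F := Completion lP.
suff -> : cexp u x = l by rewrite (exp_trunc_stable x1 mn).
apply: cvg_lim; first exact: completion_hausdorff.
move=> U [m' m'U]; exists m' => // n' /= m'n'; apply: m'U.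
by apply/cfiltBP/exp_trunc_stable.
Qed.

Lemma cexp_coord_trunc x m : x 1%N = 0 -> cexp u x m = exp_trunc u m (x m).
Proof. by move=> x1; rewrite (cexp_coord x1 (leqnn m)) exp_trunc_coord. Qed.

Lemma cexp_coord1 x : x 1%N = 0 -> cexp u x 1%N = 1.
Proof.
move=> x1; rewrite cexp_coord_trunc // /exp_trunc big_ord1 expr0 mulr1.
by rewrite fact0 invr1 !rmorph1.
Qed.

(** * Bijectivity *)

(** In $x^n-y^n=x(x^{n-1}-y^{n-1})+(x-y)y^{n-1}$ each summand gains one filtration
step, since $n\ge2$ leaves a factor of $F^1$ next to a difference. *)
Lemma subX_coord x y m i : x 1%N = 0 -> y 1%N = 0 -> x m = y m ->
  (x ^+ i.+2) m.+1 = (y ^+ i.+2) m.+1.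
Proof.
move=> x1 y1 xy; have xyX j : (x ^+ j) m = (y ^+ j) m by rewrite !ccoordX xy.
apply/cfiltBP.
have -> : x ^+ i.+2 - y ^+ i.+2 = x * (x ^+ i.+1 - y ^+ i.+1) + (x - y) * y ^+ i.+1.
  by rewrite mulrBr mulrBl -!exprS addrA subrK.
rewrite -[cfilt _ _]/(_ = 0) ccoordD.
have -> : (x * (x ^+ i.+1 - y ^+ i.+1)) m.+1 = 0.
  by rewrite -add1n; apply: coordM_eq0 => //; apply/cfiltBP.
rewrite add0r -addn1; apply: coordM_eq0; first exact/cfiltBP.
exact: coordX_eq0.
Qed.

(** The nonlinear part of the exponential is a contraction for the filtration;
hence the exponential is injective, and it has a preimage for each element of
$1 + F^1$, the fixed point of a contraction. *)
Lemma cexp_contraction x y m : x 1%N = 0 -> y 1%N = 0 -> x m = y m ->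
  (cexp u x - x) m.+1 = (cexp u y - y) m.+1.
Proof.
case: m => [|m] x1 y1 xy; first by rewrite !ccoordB !cexp_coord1 // x1 y1.
have E z : z 1%N = 0 -> (cexp u z - z) m.+2 =
    (1 + \sum_(i < m) alg_map (u (i.+2)`!%:R^-1) * z ^+ i.+2) m.+2.
  have eE : exp_trunc u m.+2 z =
      z + (1 + \sum_(i < m) alg_map (u (i.+2)`!%:R^-1) * z ^+ i.+2).
    rewrite /exp_trunc !big_ord_recl /= addrCA expr0 expr1.
    by rewrite !fact0 invr1 !rmorph1 !mul1r.
  by move=> z1; rewrite ccoordB (cexp_coord z1 (leqnn _)) -ccoordB eE addrC addKr.
rewrite (E x x1) (E y y1) [LHS]ccoordD [RHS]ccoordD; congr (_ + _).
pose G (z : completion F) i := alg_map (u (i.+2)`!%:R^-1) * z ^+ i.+2.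
rewrite (ccoord_sum m (G x)) (ccoord_sum m (G y)); apply: eq_bigr => i _.
by rewrite /G [LHS]ccoordM [RHS]ccoordM (subX_coord i x1 y1 xy).
Qed.

Lemma cexp_inj x y : x 1%N = 0 -> y 1%N = 0 -> cexp u x = cexp u y -> x = y.
Proof.
move=> x1 y1 xy; apply: completionP; elim=> [|m IH]; first by rewrite !coord0_all.
have := cexp_contraction x1 y1 IH; rewrite !ccoordB xy.
by move=> /addrI/oppr_inj.
Qed.

Lemma cexp_surj y : y 1%N = 1 -> exists2 x : completion F, x 1%N = 0 & cexp u x = y.
Proof.
move=> y1; pose T (x : completion F) := y - (cexp u x - x).
have T1 x : x 1%N = 0 -> T x 1%N = 0.
  by move=> x1; rewrite !ccoordB y1 cexp_coord1 // x1 subr0 subrr.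
(* A preimage of y is a fixed point of T. *)
pose s n := iter n T 0.
have s1 n : s n 1%N = 0 by elim: n => [|n IH] //=; apply: T1.
have sS n : s n.+1 n = s n n.
  elim: n => [|n IH]; first by rewrite !coord0_all.
  rewrite -[LHS]/(T (s n.+1) n.+1) -[RHS]/(T (s n) n.+1) [LHS]ccoordB [RHS]ccoordB.
  by rewrite (cexp_contraction _ _ IH).
have lP m : qtrans (s m.+1 m.+1) = s m m by rewrite ctransE.
pose l : completion F := Completion lP.
have l1 : l 1%N = 0 by exact: s1.
exists l => //; apply: completionP => m.
have lT : l m = T l m.
  case: m => [|m]; first by rewrite !coord0_all.
  have E : (cexp u l - l) m.+1 = (cexp u (s m) - s m) m.+1.
    exact: cexp_contraction l1 (s1 m) (erefl (s m m)).
  by rewrite -[LHS]/(T (s m) m.+1) [LHS]ccoordB [RHS]ccoordB E.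
apply: (@addIr _ (- l m)); rewrite {2}lT [T l m]ccoordB subKr.
by rewrite ccoordB.
Qed.

(** * Functional equations *)

(** With $y=x$ this is commutation, and with $y=axa^{-1}$ conjugation. *)
Lemma cexp_intertwine a x y : x 1%N = 0 -> y 1%N = 0 ->
  a * x = y * a -> a * cexp u x = cexp u y * a.
Proof.
move=> x1 y1 axy; apply: completionP => m.
rewrite !ccoordM !(cexp_coord _ (leqnn m)) // -!ccoordM; congr ((_ : completion F) m).
rewrite /exp_trunc mulr_sumr mulr_suml; apply: eq_bigr => i _.
rewrite mulrA -alg_mapC -!mulrA; congr (_ * _).
elim: (i : nat) => [|j IH]; first by rewrite !expr0 mul1r mulr1.
by rewrite exprSr mulrA IH -mulrA axy mulrA -exprSr.
Qed.

Lemma cexp_comm a x : x 1%N = 0 -> a * x = x * a -> a * cexp u x = cexp u x * a.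
Proof. by move=> x1; apply: cexp_intertwine. Qed.

(** An invertible element that commutes with $\exp x$ conjugates $x$ to an element
with the same exponential, hence to $x$. *)
Lemma cexp_comm_inv a b x : a * b = 1 -> b * a = 1 -> x 1%N = 0 ->
  a * cexp u x = cexp u x * a -> a * x = x * a.
Proof.
move=> ab ba x1 ax; pose y := a * x * b.
have y1 : y 1%N = 0 by rewrite !ccoordM x1 mulr0 mul0r.
have ya : a * x = y * a by rewrite /y -mulrA ba mulr1.
suff yx : y = x by rewrite ya yx.
apply: cexp_inj => //; move: (cexp_intertwine x1 y1 ya); rewrite ax.
by move=> /(congr1 ( *%R^~ b)); rewrite -[LHS]mulrA -[RHS]mulrA ab !mulr1.
Qed.

Lemma cexpD a b x : x 1%N = 0 ->
  cexp u (alg_map (u a) * x) * cexp u (alg_map (u b) * x) =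
  cexp u (alg_map (u (a + b)) * x).
Proof.
move=> x1; have ax1 c : (alg_map (u c) * x) 1%N = 0 by rewrite ccoordM x1 mulr0.
apply: completionP => m; rewrite ccoordM !cexp_coord_trunc //.
by apply: exp_truncD; rewrite -ccoordX; apply: coordX_eq0.
Qed.

Lemma cexp0 : cexp u (0 : completion F) = 1.
Proof.
apply: completionP => m; rewrite (cexp_coord _ (leqnSn m)) //.
rewrite /exp_trunc big_ord_recl big1 ?addr0 => [|i _].
  by rewrite fact0 invr1 !rmorph1 mul1r.
by rewrite exprS mul0r mulr0.
Qed.

Lemma cexpX n x : x 1%N = 0 -> cexp u x ^+ n = cexp u (alg_map (u n%:R) * x).
Proof.
move=> x1; elim: n => [|n IH]; first by rewrite !rmorph0 mul0r cexp0 expr0.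
rewrite exprS IH -{1}[x]mul1r -(rmorph1 (@alg_map _ _)) -(rmorph1 u).
by rewrite cexpD // nat1r.
Qed.

Lemma cexpNx x : x 1%N = 0 -> cexp u (- x) * cexp u x = 1.
Proof.
move=> x1; have <- : alg_map (u (-1)) * x = - x by rewrite !rmorphN1 mulN1r.
rewrite -{2}[x]mul1r -(rmorph1 (@alg_map _ _)) -(rmorph1 u).
by rewrite cexpD // addNr !rmorph0 mul0r cexp0 !rmorph1.
Qed.

Lemma cexpxN x : x 1%N = 0 -> cexp u x * cexp u (- x) = 1.
Proof.
move=> x1; have nx1 : (- x) 1%N = 0 by rewrite ccoordN x1 oppr0.
by have := cexpNx nx1; rewrite opprK.
Qed.

End Exponential.

Lemma filtered_coord1 (k : comPzRingType) (A B : pzAlgType k) (F : filtration A)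
    (F' : filtration B) (f : algmor (completion F) (completion F')) (x : completion F) :
  filtered f -> x 1%N = 0 -> f x 1%N = 0.
Proof. by move=> ff x1; rewrite (ff 1%N x 0) ?rmorph0. Qed.

(** Filtered morphisms are compatible with the truncations of the exponential. *)
Lemma cexp_morph (k : comPzRingType) (u : {rmorphism rat -> k})
    (A B : pzAlgType k) (F : filtration A) (F' : filtration B)
    (f : algmor (completion F) (completion F')) (x : completion F) :
  filt_mult F -> filt_mult F' -> filtered f -> x 1%N = 0 ->
  f (cexp u x) = cexp u (f x).
Proof.
move=> Fmul Fmul' ff x1; have fx1 : f x 1%N = 0 by rewrite (ff 1%N x 0) ?rmorph0.
apply: completionP => m; rewrite (cexp_coord _ Fmul' fx1 (leqnn m)).
rewrite (ff m _ _ (cexp_coord u Fmul x1 (leqnn m))); congr ((_ : completion F') m).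
rewrite rmorph_sum; apply: eq_bigr => i _.
by rewrite rmorphM rmorphXn algmor_map.
Qed.

(** Logarithms are preserved, by injectivity of the exponential. *)
Lemma log_morph (k : comPzRingType) (u : {rmorphism rat -> k})
    (A B : pzAlgType k) (F : filtration A) (F' : filtration B)
    (f : algmor (completion F) (completion F')) (x y : completion F) (l : completion F') :
  filt_mult F -> filt_mult F' -> filtered f -> x 1%N = 0 -> l 1%N = 0 ->
  cexp u x = y -> f y = cexp u l -> f x = l.
Proof.
move=> M M' ff x1 l1 <-; rewrite (cexp_morph u M M' ff x1).
exact: (cexp_inj M' (filtered_coord1 ff x1) l1).
Qed.

Lemma alg_map_comm (k : comPzRingType) (A : pzAlgType k) (a : k) (x y : A) :
  y * x = x * y -> y * (alg_map a * x) = alg_map a * x * y.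
Proof. by move=> yx; rewrite mulrA -alg_mapC -!mulrA yx. Qed.

Lemma scale_cancel (k : comPzRingType) (u : {rmorphism rat -> k}) (A : pzAlgType k)
    N (x : A) : N%:R != 0 :> rat ->
  alg_map (u N%:R) * (alg_map (u N%:R^-1) * x) = x.
Proof. by move=> N0; rewrite mulrA -!rmorphM divff // !rmorph1 mul1r. Qed.

(** A unit $x$ with $x^N \in 1 + F^1$ is the product of $\exp(\frac1N\log x^N)$ and
of an $N$-th root of unity, all factors commuting. *)
Lemma log_splitting (k : comPzRingType) (u : {rmorphism rat -> k}) (A : pzAlgType k)
    (F : filtration A) (N : nat) (x y : completion F) :
  filt_mult F -> N%:R != 0 :> rat -> x * y = 1 -> y * x = 1 -> (x ^+ N) 1%N = 1 ->
  exists l gam : completion F,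
  [/\ l 1%N = 0, cexp u l = x ^+ N,
      cexp u (alg_map (u N%:R^-1) * l) * gam = x,
      gam ^+ N = 1 & gam * l = l * gam].
Proof.
move=> M N0 xy yx xN; have [l l1 lE] := cexp_surj u M xN.
have xl : x * l = l * x.
  by apply: (cexp_comm_inv (u := u) M xy yx) => //; rewrite lE -exprS -exprSr.
pose c : completion F := alg_map (u N%:R^-1) * l.
have c1 : c 1%N = 0 by rewrite ccoordM l1 mulr0.
have nc1 : (- c) 1%N = 0 by rewrite ccoordN c1 oppr0.
have comm_c z : z * l = l * z -> z * - c = - c * z.
  by move=> zl; rewrite mulrN mulNr /c (alg_map_comm _ zl).
have hN : cexp u c ^+ N = x ^+ N by rewrite cexpX // scale_cancel.
have hk : cexp u c * cexp u (- c) = 1 by apply: cexpxN.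
have kh : cexp u (- c) * cexp u c = 1 by apply: cexpNx.
have xk : x * cexp u (- c) = cexp u (- c) * x by apply: cexp_comm => //; apply: comm_c.
have kl : l * cexp u (- c) = cexp u (- c) * l by apply: cexp_comm => //; apply: comm_c.
exists l, (x * cexp u (- c)); split=> //; rewrite -/c.
- by rewrite xk mulrA hk mul1r.
- rewrite exprMn_comm // -hN -exprMn_comm; first by rewrite hk expr1n.
  by rewrite /GRing.comm hk kh.
- by rewrite -mulrA -kl mulrA xl mulrA.
Qed.

(** * Universal properties *)

Section MakeAlgmor.
Variables (k : comPzRingType) (A B : pzAlgType k) (f : A -> B).
Hypotheses (fD : {morph f : x y / x + y}) (fM : GRing.monoid_morphism f).
Hypothesis fa : forall a : k, f (alg_map a) = alg_map a.

Let f_zmod_morphism : zmod_morphism f.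
Proof.
move=> x y; apply: (@addIr _ (f y)).
by rewrite -fD !subrK.
Qed.
HB.instance Definition _ := GRing.isZmodMorphism.Build A B f f_zmod_morphism.
HB.instance Definition _ := GRing.isMonoidMorphism.Build A B f fM.

Definition make_algmor : algmor A B := @AlgMor k A B f fa.

End MakeAlgmor.

Definition comp_algmor (k : comPzRingType) (A B C : pzAlgType k)
  (g : algmor B C) (f : algmor A B) : algmor A C.
Proof. by exists (g \o f : {rmorphism A -> C}) => a /=; rewrite !algmor_map. Defined.

Definition of_alg_algmor (k : comPzRingType) (A : pzAlgType k) (F : filtration A) :
  algmor A (completion F) :=
  @AlgMor k A (completion F) (of_alg F : {rmorphism A -> completion F}) (fun a => erefl).

Definition ccoord_algmor (k : comPzRingType) (A : pzAlgType k) (F : filtration A) m :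
  algmor (completion F) (quot (F m)) :=
  @AlgMor k _ _ (@ccoord k A F m : {rmorphism completion F -> quot (F m)})
    (fun a => erefl).

Definition qpi_algmor (k : comPzRingType) (A : pzAlgType k) (I : ideal A) :
  algmor A (quot I) :=
  @AlgMor k A (quot I) (@qpi k A I : {rmorphism A -> quot I}) (fun a => erefl).

Section QuotientLift.
Variables (k : comPzRingType) (A B : pzAlgType k) (S : A -> Prop) (f : algmor A B).
Hypothesis fS : forall x, S x -> f x = 0.

Lemma ideal_gen_ker x : ideal_gen S x -> f x = 0.
Proof. by move=> /(_ (ker_ideal f)); apply. Qed.

Definition qlift (x : quot (ideal_gen S)) : B := f (repr x).

Lemma qliftE x : qlift (qpi (ideal_gen S) x) = f x.
Proof. by apply/eqP; rewrite /qlift -subr_eq0 -rmorphB; apply/eqP/ideal_gen_ker/repr_qpi. Qed.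

Lemma qliftD : {morph qlift : x y / x + y}.
Proof.
by elim/quotW=> x; elim/quotW=> y; rewrite -(rmorphD (qpi _)) !qliftE rmorphD.
Qed.
Lemma qlift_monoid_morphism : GRing.monoid_morphism qlift.
Proof.
split; first by rewrite -(rmorph1 (qpi _)) qliftE rmorph1.
by elim/quotW=> x; elim/quotW=> y; rewrite -(rmorphM (qpi _)) !qliftE rmorphM.
Qed.
Lemma qlift_alg a : qlift (alg_map a) = alg_map a.
Proof. by rewrite [LHS]qliftE algmor_map. Qed.

Definition qlift_algmor := make_algmor qliftD qlift_monoid_morphism qlift_alg.

End QuotientLift.

Section MonoidAlgebraLift.
Variables (k : comPzRingType) (M : monoidType) (B : pzAlgType k) (v : M -> B).
Local Notation MA := (monoid_alg k M).

Lemma ma_scaleE a x : << a *g x >> = alg_map a * ma_of k x :> MA.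
Proof. by rewrite [RHS]ma_mulUU mulr1 mul1g. Qed.

Lemma ma_algmor_ext (f g : algmor MA B) :
  (forall x, f (ma_of k x) = g (ma_of k x)) -> f =1 g.
Proof.
move=> fg; elim/ma_ind => [|a x|x y fx fy]; first by rewrite !rmorph0.
  by rewrite ma_scaleE !rmorphM !algmor_map fg.
by rewrite !rmorphD fx fy.
Qed.

Hypotheses (v1 : v 1%g = 1) (vM : forall x y, v (x * y)%g = v x * v y).

Definition ma_lift (g : MA) : B := \sum_(x <- msupp g) alg_map g@_x * v x.

Lemma ma_liftw (d : {fset M}) (g : MA) :
  (msupp g `<=` d)%fset -> ma_lift g = \sum_(x <- d) alg_map g@_x * v x.
Proof.
move=> le; rewrite /ma_lift (big_fset_incl _ le) // => x _ /mcoeff_outdom ->.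
by rewrite rmorph0 mul0r.
Qed.

Lemma ma_liftD : {morph ma_lift : g h / g + h}.
Proof.
move=> g h; set d := (msupp g `|` msupp h)%fset.
rewrite (ma_liftw (msuppD_le _ _ : _ `<=` d)%fset).
rewrite (ma_liftw (fsubsetUl _ _ : _ `<=` d)%fset).
rewrite (ma_liftw (fsubsetUr _ _ : _ `<=` d)%fset).
by rewrite -big_split; apply/eq_bigr => x _; rewrite mcoeffD rmorphD mulrDl.
Qed.

Lemma ma_liftU a x : ma_lift << a *g x >> = alg_map a * v x.
Proof. by rewrite (ma_liftw msuppU_le) big_seq_fset1 mcoeffUU. Qed.

Lemma ma_lift_monoid_morphism : GRing.monoid_morphism ma_lift.
Proof.
have lift0 : ma_lift 0 = 0 by rewrite /ma_lift msupp0 big_seq_fset0.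
split=> [|g h]; first by rewrite [LHS]ma_liftU v1 rmorph1 mulr1.
elim/ma_ind: g => [|a x|g g' IH IH']; first by rewrite !(mul0r, lift0).
  elim/ma_ind: h => [|b y|h h' IH IH']; first by rewrite !(mulr0, lift0).
    rewrite [_ * _]ma_mulUU !ma_liftU rmorphM vM -!mulrA; congr (_ * _).
    by rewrite !mulrA (alg_mapC b).
  by rewrite mulrDr !ma_liftD IH IH' mulrDr.
by rewrite mulrDl !ma_liftD IH IH' mulrDl.
Qed.

Lemma ma_lift_alg a : ma_lift (alg_map a) = alg_map a.
Proof. by rewrite [LHS]ma_liftU v1 mulr1. Qed.

Definition ma_lift_algmor := make_algmor ma_liftD ma_lift_monoid_morphism ma_lift_alg.

Lemma ma_lift_of x : ma_lift_algmor (ma_of k x) = v x.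
Proof. by rewrite [LHS]ma_liftU rmorph1 mul1r. Qed.

End MonoidAlgebraLift.

(** The target is the multiplicative monoid of a ring, hence not a group: a
morphism from the free group is given by pairs of mutually inverse elements. *)
Section FreeGroupEvaluation.
Variables (T : choiceType) (B : pzRingType).

Section Evaluation.
Variable v : T * bool -> B.
Hypothesis vV : forall a, v a * v (linv a) = 1.

Definition fg_eval (w : free_group T) : B := \prod_(a <- fg_word w) v a.

Lemma fg_eval1 : fg_eval 1%g = 1.
Proof. exact: big_nil. Qed.

Lemma fg_evalM x y : fg_eval (x * y)%g = fg_eval x * fg_eval y.
Proof.
rewrite /fg_eval /=; elim: (fg_word x) => [|a s IH] /=; first by rewrite big_nil mul1r.
rewrite big_cons -mulrA -{}IH; move: (foldr (@lmul T) _ s) => w.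
case: w => [|b w] /=; first by rewrite big_seq1 big_nil mulr1.
case: eqP => [->|_]; last by rewrite big_cons.
by rewrite big_cons mulrA vV mul1r.
Qed.

Lemma fg_eval_gen x : fg_eval (fg_gen x) = v (x, false).
Proof. exact: big_seq1. Qed.

End Evaluation.

(** The value at an inverse of a generator is forced, by uniqueness of inverses
in the multiplicative monoid. *)
Lemma fg_morph_ext (f g : free_group T -> B) :
  f 1%g = 1 -> (forall x y, f (x * y)%g = f x * f y) ->
  g 1%g = 1 -> (forall x y, g (x * y)%g = g x * g y) ->
  (forall x, f (fg_gen x) = g (fg_gen x)) -> f =1 g.
Proof.
move=> f1 fM g1 gM fg [w wr].
elim: w wr => [|a w IH] awr.
  have -> : FreeGroup awr = 1%g :> free_group T by exact: val_inj.
  by rewrite f1 g1.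
have wr : reduced w by exact: path_sorted awr.
pose L : free_group T := if a.2 then ((fg_gen a.1)^-1)%g else fg_gen a.1.
have -> : FreeGroup awr = (L * FreeGroup wr)%g :> free_group T.
  apply: val_inj => /=; have -> : fg_word L = [:: a].
    by rewrite /L; case: (a) => x [].
  by move: awr => /=; case: (w) => [//|b w'] /= /andP[/negPf ->].
rewrite fM gM IH; congr (_ * _); rewrite /L; case: a.2 => //.
have h x : (x^-1 * x = 1 :> free_group T)%g by exact: mulVg.
rewrite -[LHS]mulr1 -g1 -(mulgV (fg_gen a.1)) gM mulrA -fg -fM h f1 mul1r.
by [].
Qed.

End FreeGroupEvaluation.

(** * Roots of unity *)

(** With $t=\pi n/N\in(0,\pi)$, the real part of the power is $\cos2t=1-2\sin^2t<1$. *)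
Lemma zetaX_neq1 (R : realType) N n : (0 < n < N)%N -> zeta R N ^+ n != 1.
Proof.
move=> /andP[n0 nN]; rewrite /zeta cos_sinX.
have N0 : 0 < N%:R :> R by rewrite ltr0n (ltn_trans n0).
have N1 : N%:R != 0 :> R by rewrite gt_eqF.
pose t : R := trigo.pi * n%:R / N%:R.
have -> : (2 * trigo.pi / N%:R : R) *+ n = t *+ 2.
  by rewrite -[LHS]mulr_natr -[RHS]mulr_natr /t; field.
have t0 : 0 < t by rewrite divr_gt0 // mulr_gt0 ?trigo.pi_gt0 ?ltr0n.
have tpi : t < trigo.pi by rewrite ltr_pdivrMr // ltr_pM2l ?trigo.pi_gt0 // ltr_nat.
apply/negP => /eqP /(congr1 (fun z => complex.Re z)) /=.
rewrite cos_mulr2n cos2sin2 => c1.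
have /eqP : sin t ^+ 2 = 0 by lra.
rewrite expf_eq0 /= => /eqP st.
by have := @sin_gt0_pi R t; rewrite t0 tpi => /(_ isT); rewrite st ltxx.
Qed.

Section Embedding.
Variables (R : realType) (gT : finGroupType) (N : nat) (iota : gT -> R[i]).
Hypotheses (G_cyclic : cyclic [set: gT]) (G_order : #|[set: gT]| = N).
Hypothesis iotaP : group_embedding iota.

Lemma iotaM : {morph iota : g h / (g * h)%g >-> g * h}.
Proof. by case: iotaP. Qed.
Lemma iota_inj : injective iota.
Proof. by case: iotaP. Qed.
Lemma iota1 : iota 1%g = 1.
Proof.
have [U _ _] := iotaP; apply: (mulrI (U 1%g)).
by rewrite -iotaM mulg1 mulr1.
Qed.
Lemma iotaX g n : iota (g ^+ n)%g = iota g ^+ n.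
Proof. by elim: n => [|n IH]; rewrite ?iota1 // expgS exprS iotaM IH. Qed.

Lemma N_gt0 : (0 < N)%N.
Proof. by rewrite -G_order cardG_gt0. Qed.

Lemma iota_unity g : iota g ^+ N = 1.
Proof. by rewrite -iotaX -G_order expg_cardG ?inE // iota1. Qed.

(** The image of a generator of $G$ is a primitive root of unity, of which all
roots of unity are powers. *)
Lemma iota_surj z : z ^+ N = 1 -> exists g, iota g = z.
Proof.
move=> zN; have /cyclicP[g0 Gg0] := G_cyclic.
have [m mprim mN] := prim_order_exists N_gt0 (iota_unity g0).
have Nm : (N %| m)%N.
  rewrite -G_order Gg0 -[#|_|]/(#[g0])%g order_dvdn; apply/eqP/iota_inj.
  by rewrite iotaX iota1 (prim_expr_order mprim).
have E : m = N by apply/eqP; rewrite eqn_dvd mN Nm.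
rewrite E in mprim.
have [i ->] := prim_rootP mprim zN.
by exists (g0 ^+ i)%g; rewrite iotaX.
Qed.

Lemma iota_g_iota : iota (g_iota N iota) = zeta R N.
Proof.
rewrite /g_iota; case: pickP => [g /eqP //|noroot].
have /andP[_ /eqP /iota_surj[g gz]] := zetaP R N.
by have := noroot g; rewrite gz eqxx.
Qed.

Lemma g_iota_order : #[g_iota N iota]%g = N.
Proof.
apply/eqP; rewrite eqn_leq dvdn_leq ?N_gt0 //=; last first.
  by rewrite order_dvdn -G_order expg_cardG ?inE.
rewrite leqNgt; apply/negP => lt.
have : zeta R N ^+ #[g_iota N iota]%g != 1 by rewrite zetaX_neq1 ?order_gt0.
by rewrite -iota_g_iota -iotaX expg_order iota1 eqxx.
Qed.

Lemma g_iota_gen g : exists n, g = (g_iota N iota ^+ n)%g.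
Proof.
apply/cycleP; suff -> : <[g_iota N iota]>%g = [set: gT]%g by rewrite inE.
apply/eqP; rewrite eqEcard finset.subsetT /= G_order.
by have := g_iota_order; rewrite /order => ->.
Qed.

(** The inverse of the isomorphism $G\simeq\mu_N$ given by $\iota$. *)
Definition mu_log (z : mu R N) : gT := odflt 1%g [pick g | iota g == mu_val z].

Lemma mu_logE z g : iota g = mu_val z -> mu_log z = g.
Proof.
move=> gz; rewrite /mu_log; case: pickP => [h /eqP hz|/(_ g)].
  by apply: iota_inj; rewrite hz.
by rewrite gz eqxx.
Qed.

Lemma mu_logK z : iota (mu_log z) = mu_val z.
Proof.
have /andP[_ /eqP/iota_surj[g gz]] := muP z.
by rewrite (mu_logE gz).
Qed.

Lemma mu_log1 : mu_log 1%g = 1%g.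
Proof. by apply: mu_logE; rewrite iota1. Qed.

Lemma mu_logM x y : mu_log (x * y)%g = (mu_log x * mu_log y)%g.
Proof. by apply: mu_logE; rewrite iotaM !mu_logK. Qed.

Lemma mu_log_zeta : mu_log (zeta_mu R N) = g_iota N iota.
Proof. by apply: mu_logE; rewrite iota_g_iota. Qed.

End Embedding.

(** * The Betti algebra *)

Lemma ideal_mul_ind (A : pzRingType) (I J : ideal A) (P : A -> Prop) :
  P 0 -> (forall x y, P x -> P y -> P (x + y)) ->
  (forall a b, I a -> J b -> P (a * b)) -> forall x, ideal_mul I J x -> P x.
Proof.
move=> P0 PD PM _ [s sP ->]; rewrite big_seq.
by elim/big_ind: _ => // p /sP[p1 p2]; apply: PM.
Qed.

Lemma ideal_powM (A : pzRingType) (I : ideal A) m n x y :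
  ideal_pow I m x -> ideal_pow I n y -> ideal_pow I (m + n) (x * y).
Proof.
elim: m x => [|m IH] x; first by move=> _; apply: idealMl.
move=> xm yn; rewrite addSn; move: x xm; apply: ideal_mul_ind => [|a b|a b aI bI].
- by rewrite mul0r; apply: ideal0.
- by rewrite mulrDl; apply: idealD.
exists [:: (a, b * y)]; last by rewrite big_seq1 mulrA.
by move=> p; rewrite inE => /eqP -> /=; split=> //; apply: IH.
Qed.

Lemma VB_mult R k N : filt_mult (VB_filt R k N).
Proof. by split=> // m n x y; apply: ideal_powM. Qed.

Section BettiLift.
Variables (k : comPzRingType) (B : pzAlgType k) (v : bool * bool -> B).
Hypothesis vV : forall a, v a * v (linv a) = 1.

Definition VB_lift : algmor (VB k) B :=
  ma_lift_algmor (@fg_eval1 _ _ v) (fg_evalM vV).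

Lemma VB_lift_gen b : VB_lift (ma_of k (fg_gen b : F2)) = v (b, false).
Proof. by rewrite [LHS]ma_lift_of fg_eval_gen. Qed.

End BettiLift.

Lemma ma_of1 (k : comPzRingType) (M : monoidType) : ma_of k (1%g : M) = 1. Proof. by []. Qed.
Lemma ma_ofM (k : comPzRingType) (M : monoidType) (x y : M) :
  ma_of k (x * y)%g = ma_of k x * ma_of k y.
Proof. by rewrite [RHS]ma_mulUU mulr1. Qed.

Lemma VB_algmor_ext (k : comPzRingType) (B : pzAlgType k) (f g : algmor (VB k) B) :
  (forall b, f (ma_of k (fg_gen b : F2)) = g (ma_of k (fg_gen b : F2))) -> f =1 g.
Proof.
move=> fg; apply: ma_algmor_ext.
apply: (@fg_morph_ext bool B (f \o @ma_of k F2) (g \o @ma_of k F2)) => //=.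
- by rewrite ma_of1 rmorph1.
- by move=> x y; rewrite ma_ofM rmorphM.
- by rewrite ma_of1 rmorph1.
- by move=> x y; rewrite ma_ofM rmorphM.
Qed.

Definition ma_map_algmor (k : comPzRingType) (M M' : monoidType)
  (phi : UMagmaMorphism.type M M') : algmor (monoid_alg k M) (monoid_alg k M').
Proof.
exists (ma_map phi : {rmorphism monoid_alg k M -> monoid_alg k M'}) => a.
by rewrite [LHS]ma_mapU gmulf1.
Defined.

(** * The de Rham algebra *)

Lemma VDR_mult k gT : filt_mult (VDR_filt k gT).
Proof.
split; first by exists 1; [move=> w _|rewrite rmorph1].
move=> m n _ _ [p pm ->] [q qn ->]; exists (p * q); last by rewrite rmorphM.
exact: deg_geM.
Qed.

Section DeRhamLift.
Variables (k : comPzRingType) (gT : finGroupType) (B : pzAlgType k).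
Local Notation dr := (@ideal_gen (dr_free k gT) (@dr_rel k gT)).

Lemma VDR_algmor_ext (f g : algmor (VDR k gT) B) :
  (forall c, f (qpi dr (letter k c)) = g (qpi dr (letter k c))) -> f =1 g.
Proof.
move=> fg; elim/quotW; apply: (@ma_algmor_ext _ _ _ (comp_algmor f (qpi_algmor dr))
  (comp_algmor g (qpi_algmor dr))) => w /=.
elim: w => [|c w IH]; first by rewrite [ma_of _ _](ma_of1 k (words (dr_gen gT))) !rmorph1.
have -> : ma_of k (c :: w : words (dr_gen gT)) = letter k c * ma_of k (w : words (dr_gen gT)).
  exact: (@ma_ofM k (words (dr_gen gT)) [:: c] w).
by rewrite !rmorphM IH fg.
Qed.

Variables (a0 a1 : B) (gam : gT -> B).
Hypotheses (gam1 : gam 1%g = 1) (gamM : forall g h, gam (g * h)%g = gam g * gam h).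
Hypothesis gam_a0 : forall g, gam g * a0 = a0 * gam g.

Definition dr_val (c : dr_gen gT) : B :=
  match c with inl false => a0 | inl true => a1 | inr g => gam g end.

Definition dr_prod (w : words (dr_gen gT)) : B := \prod_(c <- w) dr_val c.

Lemma dr_prod1 : dr_prod 1%g = 1.
Proof. exact: big_nil. Qed.
Lemma dr_prodM v w : dr_prod (v * w)%g = dr_prod v * dr_prod w.
Proof. exact: big_cat. Qed.

Definition dr_free_lift : algmor (dr_free k gT) B := ma_lift_algmor dr_prod1 dr_prodM.

Lemma dr_free_letter c : dr_free_lift (letter k c) = dr_val c.
Proof. by rewrite [LHS]ma_lift_of [LHS]big_seq1. Qed.

Lemma dr_free_rel x : dr_rel x -> dr_free_lift x = 0.
Proof.
(* The lift and the letters are generalized, as rewriting would unfold them. *)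
have LE := dr_free_letter; move: dr_free_lift LE => L LE.
case=> [g h||g]; move: (@letter k gT) LE => l LE; rewrite rmorphB.
- by rewrite rmorphM !LE -gamM subrr.
- by rewrite rmorph1 LE -gam1 subrr.
- by rewrite !rmorphM !LE /= gam_a0 subrr.
Qed.

Definition VDR_lift : algmor (VDR k gT) B := qlift_algmor dr_free_rel.

Lemma VDR_lift_letter c : VDR_lift (qpi dr (letter k c)) = dr_val c.
Proof. by rewrite [LHS](qliftE dr_free_rel) dr_free_letter. Qed.

End DeRhamLift.

(** A word of degree $m$ is sent to a product with $m$ factors in $F^1$. *)
Lemma VDR_lift_filt (k : comPzRingType) (gT : finGroupType) (A : pzAlgType k)
    (F : filtration A) (a0 a1 : completion F) (gam : gT -> completion F)
    (gam1 : gam 1%g = 1) (gamM : forall g h, gam (g * h)%g = gam g * gam h)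
    (gam_a0 : forall g, gam g * a0 = a0 * gam g) m (x : VDR k gT) :
  filt_mult F -> a0 1%N = 0 -> a1 1%N = 0 -> VDR_filt k gT m x ->
  VDR_lift a1 gam1 gamM gam_a0 x m = 0.
Proof.
move=> Fmul a01 a11 [p pm ->].
rewrite [VDR_lift _ _ _ _ _](qliftE (@dr_free_rel _ _ _ a0 a1 gam gam1 gamM gam_a0)).
rewrite -[dr_free_lift _ _ _ _]/(ma_lift _ p) /ma_lift.
rewrite -[LHS]/(ccoord m _) rmorph_sum big_seq big1 // => w /pm wm.
suff dw : dr_prod a0 a1 gam w m = 0.
  by rewrite -[LHS]/((alg_map p@_w * dr_prod a0 a1 gam w : completion F) m) ccoordM dw mulr0.
apply: (coord_eq0_le wm); elim: w {wm} => [|c w IH].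
  exact: coord0_all.
rewrite /dr_prod big_cons /dr_deg /=; apply: coordM_eq0 => //.
by case: c => [[]|g] //; apply: coord0_all.
Qed.

Section DeRhamClasses.
Variables (k : comPzRingType) (gT : finGroupType).

Definition dr_quot : algmor (dr_free k gT) (VDRhat k gT) :=
  comp_algmor (of_alg_algmor (VDR_filt k gT)) (qpi_algmor (ideal_gen (@dr_rel k gT))).

Lemma dr_quot_rel x : dr_rel x -> dr_quot x = 0.
Proof.
move=> xr; suff -> : dr_quot x = of_alg (VDR_filt k gT) (qpi _ 0) by rewrite !rmorph0.
by congr of_alg; apply/qpiP; rewrite subr0 => J; apply.
Qed.

Lemma grp1 : grp k (1%g : gT) = 1.
Proof.
have := dr_quot_rel (@dr_rel1 k gT); rewrite -[grp _ _]/(dr_quot (letter k (inr 1%g))).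
move: (@letter k gT) => l; rewrite rmorphB rmorph1.
by move=> /eqP; rewrite subr_eq0 => /eqP.
Qed.

Lemma grpM (g h : gT) : grp k (g * h)%g = grp k g * grp k h.
Proof.
rewrite -[RHS]/(dr_quot (letter k (inr g)) * dr_quot (letter k (inr h))).
rewrite -[LHS]/(dr_quot (letter k (inr (g * h)%g))).
move: (dr_quot_rel (dr_relM k g h)); move: (@letter k gT) => l; rewrite rmorphB rmorphM.
by move=> /eqP; rewrite subr_eq0 => /eqP ->.
Qed.

Lemma grpX (g : gT) n : grp k (g ^+ n)%g = grp k g ^+ n.
Proof. by elim: n => [|n IH]; rewrite ?grp1 // expgS exprS grpM IH. Qed.

Lemma grp_e0 (g : gT) : grp k g * e0 k gT = e0 k gT * grp k g.
Proof.
have := dr_quot_rel (dr_relC k g).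
rewrite -[grp _ _]/(dr_quot (letter k (inr g))) -[e0 _ _]/(dr_quot (letter k (inl false))).
move: (@letter k gT) => l; rewrite rmorphB !rmorphM.
by move=> /eqP; rewrite subr_eq0 => /eqP.
Qed.

Lemma dr_class_inl_coord1 b : dr_class k (inl b : dr_gen gT) 1%N = 0.
Proof.
apply/of_alg_coord0; exists (letter k (inl b)) => // w.
by rewrite /letter /ma_of => /(fsubsetP msuppU_le); rewrite inE => /eqP ->.
Qed.

Lemma e0_coord1 : e0 k gT 1%N = 0. Proof. exact: dr_class_inl_coord1. Qed.
Lemma e1_coord1 : e1 k gT 1%N = 0. Proof. exact: dr_class_inl_coord1. Qed.

End DeRhamClasses.

(** * The isomorphism *)

Section Comparison.
Variables (R : realType) (k : comPzRingType) (u : {rmorphism rat -> k}).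
Variables (gT : finGroupType) (N : nat) (iota : gT -> R[i]).
Hypotheses (G_cyclic : cyclic [set: gT]) (G_order : #|[set: gT]| = N).
Hypothesis iotaP : group_embedding iota.

Local Notation AH := (VBhat R k N).
Local Notation BH := (VDRhat k gT).
Local Notation gi := (g_iota N iota).

Definition scaled_e0 : BH := alg_map (u N%:R^-1) * e0 k gT.

Lemma scaled_e0_coord1 : scaled_e0 1%N = 0.
Proof. by rewrite ccoordM e0_coord1 mulr0. Qed.

Lemma N_neq0 : N%:R != 0 :> rat.
Proof. by rewrite pnatr_eq0 -lt0n (N_gt0 G_order). Qed.

Definition VB_to_VDR_letter (a : bool * bool) : BH :=
  match a with
  | (false, false) => cexp u scaled_e0 * grp k gi
  | (false, true) => grp k gi^-1%g * cexp u (- scaled_e0)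
  | (true, false) => cexp u (e1 k gT)
  | (true, true) => cexp u (- e1 k gT)
  end.

Lemma grpV (g : gT) : grp k g * grp k g^-1%g = 1.
Proof. by rewrite -grpM mulgV grp1. Qed.
Lemma grpVl (g : gT) : grp k g^-1%g * grp k g = 1.
Proof. by rewrite -grpM mulVg grp1. Qed.

Lemma VB_to_VDR_letterV a : VB_to_VDR_letter a * VB_to_VDR_letter (linv a) = 1.
Proof.
have M := VDR_mult k gT; have s1 := scaled_e0_coord1; have e1 := e1_coord1 k gT.
case: a => [[] []] /=.
- exact: cexpNx.
- exact: cexpxN.
- by rewrite mulrA -[X in X * _]mulrA cexpNx // mulr1 grpVl.
- by rewrite mulrA -[X in X * _]mulrA grpV mulr1 cexpxN.
Qed.

Definition VB_to_VDR : algmor (VB k) BH := VB_lift VB_to_VDR_letterV.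

Lemma F2_mu_gen b : F2_mu R N (fg_gen b) = if b then 1%g else zeta_mu R N.
Proof. exact: mulg1. Qed.

Lemma F2_mu_X0N : F2_mu R N (fg_gen false ^+ N : F2)%g = 1%g.
Proof.
rewrite gmulfXn [X in (X ^+ _)%g](F2_mu_gen false); apply: val_inj.
have valX n : mu_val (zeta_mu R N ^+ n)%g = zeta R N ^+ n.
  by elim: n => // n IH; rewrite expgS exprS -IH.
by have /andP[_ /eqP] := zetaP R N; rewrite -valX.
Qed.

(** Modulo degree 1 the exponentials become 1, so the morphism factors through
$\mathbf k\mu_N$. *)
Lemma VB_to_VDR_filt1 x : VB_ideal R k N x -> VB_to_VDR x 1%N = 0.
Proof.
move=> xI; have M := VDR_mult k gT.
pose v (z : mu R N) : quot (VDR_filt k gT 1) := grp k (mu_log iota z) 1%N.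
have v1 : v 1%g = 1 by rewrite /v mu_log1 // grp1.
have vM y z : v (y * z)%g = v y * v z by rewrite /v (mu_logM G_cyclic) // grpM ccoordM.
have E : comp_algmor (ccoord_algmor _ 1) VB_to_VDR =1
    comp_algmor (ma_lift_algmor v1 vM) (ma_map_algmor k (@F2_mu R N)).
  apply: VB_algmor_ext => b.
  rewrite -[LHS]/(VB_to_VDR (ma_of k (fg_gen b : F2)) 1%N) VB_lift_gen.
  rewrite -[RHS]/(ma_lift_algmor v1 vM (ma_map (@F2_mu R N) (ma_of k (fg_gen b : F2)))).
  have -> : ma_map (@F2_mu R N) (ma_of k (fg_gen b : F2)) =
      ma_of k (if b then 1%g else zeta_mu R N).
    by rewrite [LHS]ma_mapU -[LHS]/(ma_of k (F2_mu R N (fg_gen b))) F2_mu_gen.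
  rewrite ma_lift_of; case: b.
    by rewrite v1 -[LHS]/(cexp u (e1 k gT) 1%N) cexp_coord1 ?e1_coord1.
  rewrite -[LHS]/((cexp u scaled_e0 * grp k gi) 1%N) ccoordM.
  rewrite cexp_coord1 ?scaled_e0_coord1 // mul1r.
  by rewrite /v (mu_log_zeta G_cyclic G_order).
rewrite [LHS]E -[LHS]/(ma_lift_algmor v1 vM (ma_map (@F2_mu R N) x)).
by rewrite (xI : ma_map _ x = 0) rmorph0.
Qed.

Lemma VB_to_VDR_filt m x : VB_filt R k N m x -> VB_to_VDR x m = 0.
Proof.
have M := VDR_mult k gT; elim: m x => [|m IH] x; first by move=> _; apply: coord0_all.
pose K := ker_ideal (comp_algmor (ccoord_algmor (VDR_filt k gT) m.+1) VB_to_VDR).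
move: x; apply: (@ideal_mul_ind _ _ _ K) => [|a b|a b aI bI].
- exact: ideal0.
- exact: idealD.
suff -> : K (a * b) = ((VB_to_VDR a * VB_to_VDR b) m.+1 = 0).
  by rewrite -add1n; apply: coordM_eq0 => //; [apply: VB_to_VDR_filt1|apply: IH].
by rewrite -(rmorphM VB_to_VDR).
Qed.

Definition iso_V : algmor AH BH := ext_algmor VB_to_VDR_filt.

Lemma iso_V_filtered : filtered iso_V.
Proof. exact: ext_filtered. Qed.

Lemma iso_V_X0 : iso_V (X0 R k N) = cexp u scaled_e0 * grp k gi.
Proof. by rewrite [LHS]ext_of_alg [LHS]VB_lift_gen. Qed.

Lemma iso_V_X1 : iso_V (X1 R k N) = cexp u (e1 k gT).
Proof. by rewrite [LHS]ext_of_alg [LHS]VB_lift_gen. Qed.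

Definition F2_class (x : F2) : AH := of_alg (VB_filt R k N) (ma_of k x).

Lemma F2_class1 : F2_class 1%g = 1.
Proof. by []. Qed.

Lemma F2_classM x y : F2_class (x * y)%g = F2_class x * F2_class y.
Proof.
have := rmorphM (of_alg_algmor (VB_filt R k N)) (ma_of k x) (ma_of k y).
by rewrite -ma_ofM.
Qed.

(** If $x$ maps to $1$ in $\mu_N$ then $x-1\in\mathcal I$. *)
Lemma F2_class_coord1 x : F2_mu R N x = 1%g -> F2_class x 1%N = 1.
Proof.
move=> x1; apply/qpiP.
exists [:: (ma_of k x - 1, 1)]; last by rewrite big_seq1 mulr1.
move=> p; rewrite inE => /eqP -> /=; split=> //.
rewrite rmorphB rmorph1; apply/eqP; rewrite subr_eq0; apply/eqP.
by rewrite [LHS]ma_mapU -[LHS]/(ma_of k (F2_mu R N x)) x1.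
Qed.

Lemma F2_classV x : F2_class x * F2_class x^-1%g = 1.
Proof. by rewrite -F2_classM mulgV. Qed.
Lemma F2_classVl x : F2_class x^-1%g * F2_class x = 1.
Proof. by rewrite -F2_classM mulVg. Qed.

Lemma F2_classX x n : F2_class (x ^+ n)%g = F2_class x ^+ n.
Proof.
elim: n => [|n IH]; first by rewrite expr0 expg0 F2_class1.
by rewrite exprS -IH expgS F2_classM.
Qed.

Lemma X0_log_splitting : exists l gam : AH,
  [/\ l 1%N = 0, cexp u l = X0 R k N ^+ N,
      cexp u (alg_map (u N%:R^-1) * l) * gam = X0 R k N,
      gam ^+ N = 1 & gam * l = l * gam].
Proof.
apply: (log_splitting u (VB_mult R k N) N_neq0 (F2_classV _) (F2_classVl _)).
by rewrite -F2_classX; apply/F2_class_coord1/F2_mu_X0N.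
Qed.

Lemma X1_log : exists2 l : AH, l 1%N = 0 & cexp u l = X1 R k N.
Proof. exact: (cexp_surj u (VB_mult R k N) (F2_class_coord1 (F2_mu_gen true))). Qed.

(** The inverse is given by $e_1\mapsto\log X_1$, $e_0\mapsto\log X_0^N$ and
$g_\iota\mapsto X_0\exp(-\frac1N\log X_0^N)$; each equation of the statement
characterizes one of these values.  A general $h\in G$ is sent to a power of the last
element with the exponent of $h$ as a power of $g_\iota$, which is well defined
modulo $N$. *)
Lemma inverse_exists : exists g : algmor BH AH,
  [/\ filtered g, cexp u (g (e0 k gT)) = X0 R k N ^+ N,
      cexp u (g (e1 k gT)) = X1 R k N
    & cexp u (alg_map (u N%:R^-1) * g (e0 k gT)) * g (grp k gi) = X0 R k N].
Proof.
have [l0 [gam [l01 l0E l0gam gamN gam_l0]]] := X0_log_splitting.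
have [l1 l11 l1E] := X1_log.
have [dlog dlogE] := choice (g_iota_gen G_cyclic G_order iotaP).
have gam_eq m n : (gi ^+ m = gi ^+ n)%g -> gam ^+ m = gam ^+ n.
  move=> /eqP; rewrite eq_expg_mod_order (g_iota_order G_cyclic G_order iotaP) => /eqP mn.
  by rewrite -(expr_mod m gamN) mn expr_mod.
pose gamG h := gam ^+ dlog h.
have gamG1 : gamG 1%g = 1 by rewrite -(expr0 gam); apply: gam_eq; rewrite -dlogE.
have gamGM h h' : gamG (h * h')%g = gamG h * gamG h'.
  by rewrite -exprD; apply: gam_eq; rewrite expgD -!dlogE.
have gamG_l0 h : gamG h * l0 = l0 * gamG h.
  exact: (esym (commrX (dlog h) (esym gam_l0))).
pose psi := VDR_lift l1 gamG1 gamGM gamG_l0.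
have psiF m x : VDR_filt k gT m x -> psi x m = 0.
  exact: (@VDR_lift_filt k gT _ _ l0 l1 gamG gamG1 gamGM gamG_l0 m x (VB_mult R k N) l01 l11).
have psiE c : ext_algmor psiF (dr_class k c) = dr_val l0 l1 gamG c.
  rewrite [LHS](ext_of_alg psiF).
  exact: (@VDR_lift_letter k gT _ l0 l1 gamG gamG1 gamGM gamG_l0 c).
have psi_e0 : ext_algmor psiF (e0 k gT) = l0 := psiE (inl false).
have psi_e1 : ext_algmor psiF (e1 k gT) = l1 := psiE (inl true).
have psi_gi : ext_algmor psiF (grp k gi) = gam.
  rewrite -[RHS]expr1 [LHS](psiE (inr gi)).
  by apply: gam_eq; rewrite -dlogE expg1.
have psi_filt : filtered (ext_algmor psiF) by exact: ext_filtered.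
exists (ext_algmor psiF); split; first exact: psi_filt.
- exact: etrans (congr1 (cexp u) psi_e0) l0E.
- exact: etrans (congr1 (cexp u) psi_e1) l1E.
pose E (l : AH) := cexp u (alg_map (u N%:R^-1) * l).
exact: etrans (congr2 *%R (congr1 E psi_e0) psi_gi) l0gam.
Qed.

Section Composites.
Variable g : algmor BH AH.
Hypotheses (g_filt : filtered g) (g_e0 : cexp u (g (e0 k gT)) = X0 R k N ^+ N).
Hypothesis g_e1 : cexp u (g (e1 k gT)) = X1 R k N.
Hypothesis g_gi :
  cexp u (alg_map (u N%:R^-1) * g (e0 k gT)) * g (grp k gi) = X0 R k N.

Lemma g_scaled_e0 : g (cexp u scaled_e0) = cexp u (alg_map (u N%:R^-1) * g (e0 k gT)).
Proof.
rewrite (cexp_morph u (VDR_mult k gT) (VB_mult R k N) g_filt scaled_e0_coord1).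
by rewrite (rmorphM g) algmor_map.
Qed.

Lemma iso_VK : cancel iso_V g.
Proof.
apply: (@continuous_ext _ _ _ _ _ (g \o iso_V) id).
- by apply: filtered_continuous => m x y xy; apply/g_filt/iso_V_filtered.
- exact: filtered_continuous.
apply: (@VB_algmor_ext _ _ (comp_algmor g (comp_algmor iso_V (of_alg_algmor _)))
  (of_alg_algmor _)) => -[].
  rewrite -[LHS]/(g (iso_V (X1 R k N))) iso_V_X1.
  apply: etrans g_e1.
  exact: (cexp_morph u (VDR_mult k gT) (VB_mult R k N) g_filt (e1_coord1 k gT)).
by rewrite -[LHS]/(g (iso_V (X0 R k N))) iso_V_X0 (rmorphM g) g_scaled_e0.
Qed.

Lemma iso_V_e1 : iso_V (g (e1 k gT)) = e1 k gT.
Proof.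
apply: (log_morph (VB_mult R k N) (VDR_mult k gT) iso_V_filtered _ (e1_coord1 k gT) g_e1).
  exact: (filtered_coord1 g_filt (e1_coord1 k gT)).
exact: iso_V_X1.
Qed.

(** The image of $X_0^N$ is $\exp(\frac1Ne_0)^Ng_\iota^N=\exp e_0$. *)
Lemma iso_V_e0 : iso_V (g (e0 k gT)) = e0 k gT.
Proof.
apply: (log_morph (VB_mult R k N) (VDR_mult k gT) iso_V_filtered _ (e0_coord1 k gT) g_e0).
  exact: (filtered_coord1 g_filt (e0_coord1 k gT)).
rewrite (rmorphXn iso_V) iso_V_X0 exprMn_comm; last first.
  apply/esym/(cexp_comm u (VDR_mult k gT) scaled_e0_coord1).
  exact: (alg_map_comm _ (grp_e0 k gi)).
have giN : (gi ^+ N = 1)%g.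
  by apply/eqP; rewrite -order_dvdn (g_iota_order G_cyclic G_order iotaP).
rewrite -grpX giN grp1 mulr1.
by rewrite (cexpX u (VDR_mult k gT) N scaled_e0_coord1) (scale_cancel u _ N_neq0).
Qed.

(** Both sides become the image of $X_0$ when multiplied by $\exp(\frac1Ne_0)$. *)
Lemma iso_V_gi : iso_V (g (grp k gi)) = grp k gi.
Proof.
have M := VDR_mult k gT.
have := iso_V_X0; rewrite -{1}g_gi (rmorphM iso_V) -g_scaled_e0.
have -> : iso_V (g (cexp u scaled_e0)) = cexp u scaled_e0.
  rewrite g_scaled_e0 (cexp_morph u (VB_mult R k N) M iso_V_filtered).
    by rewrite (rmorphM iso_V) algmor_map iso_V_e0.
  by rewrite ccoordM (filtered_coord1 g_filt (e0_coord1 k gT)) mulr0.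
move=> /(congr1 ( *%R (cexp u (- scaled_e0)))).
by rewrite [LHS]mulrA [RHS]mulrA (cexpNx u M scaled_e0_coord1) !mul1r.
Qed.

Lemma iso_V_Kr : cancel g iso_V.
Proof.
apply: (@continuous_ext _ _ _ _ _ (iso_V \o g) id).
- by apply: filtered_continuous => m x y xy; apply/iso_V_filtered/g_filt.
- exact: filtered_continuous.
apply: (@VDR_algmor_ext _ _ _ (comp_algmor iso_V (comp_algmor g (of_alg_algmor _)))
  (of_alg_algmor _)) => -[[]|h].
- exact: iso_V_e1.
- exact: iso_V_e0.
rewrite -[LHS]/(iso_V (g (grp k h))) -[RHS]/(grp k h).
have [n ->] := g_iota_gen G_cyclic G_order iotaP h.
by rewrite grpX (rmorphXn g) (rmorphXn iso_V) iso_V_gi.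
Qed.

End Composites.

Lemma iso_V_unique (f : AH -> BH) : topalg_iso f ->
  f (X0 R k N) = cexp u scaled_e0 * grp k gi -> f (X1 R k N) = cexp u (e1 k gT) ->
  iso_V =1 f.
Proof.
move=> [fD fM fa [_ [_ _ cf _]]] fX0 fX1.
apply: continuous_ext => //; first exact/filtered_continuous/iso_V_filtered.
apply: (@VB_algmor_ext _ _ (comp_algmor iso_V (of_alg_algmor _))
  (comp_algmor (make_algmor fD fM fa) (of_alg_algmor _))) => -[].
- by rewrite -[LHS]/(iso_V (X1 R k N)) iso_V_X1 -fX1.
- by rewrite -[LHS]/(iso_V (X0 R k N)) iso_V_X0 -fX0.
Qed.

End Comparison.

Theorem mainTheorem7 (R : realType) (k : comPzRingType)
    (u : {rmorphism rat -> k}) (gT : finGroupType) (N : nat)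
    (iota : gT -> R[i]) (G_cyclic : cyclic [set: gT])
    (G_order : #|[set: gT]| = N) (iota_embedding : group_embedding iota) :
  exists! f : VBhat R k N -> VDRhat k gT,
    [/\ topalg_iso f,
        f (X0 R k N) =
          cexp u (alg_map (u N%:R^-1) * e0 k gT) * grp k (g_iota N iota)
      & f (X1 R k N) = cexp u (e1 k gT)].
Proof.
have [g [g_filt g_e0 g_e1 g_gi]] := inverse_exists u G_cyclic G_order iota_embedding.
have fK := iso_VK G_cyclic G_order iota_embedding g_filt g_e1 g_gi.
have gK := iso_V_Kr G_cyclic G_order iota_embedding g_filt g_e0 g_e1 g_gi.
exists (iso_V u G_cyclic G_order iota_embedding); split; last first.
  by move=> f [f_iso fX0 fX1]; apply/funext/iso_V_unique.
split; [split|exact: iso_V_X0|exact: iso_V_X1].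
- exact: rmorphD.
- exact: ext_monoid_morphism.
- exact: algmor_map.
exists g; split; [exact: fK|exact: gK| |exact: filtered_continuous].
exact/filtered_continuous/iso_V_filtered.
Qed.
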